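(* Let $f \in \mathcal{C}_{2\pi}$, let $A_n[f]$ be the Toeplitz matrix generated by $f$ and $c_n[f]$ the optimal circulant preconditioner for $A_n[f]$. For every $\epsilon>0$ there exist positive integers $N$ and $M$ such that for every $n>N$ there are matrices $R_n[f],E_n[f]\in\mathbb{C}^{n\times n}$ with \[ e^{c_n[f]}-e^{A_n[f]} = R_n[f]+E_n[f],\qquad \operatorname{rank} R_n[f]\le 2M,\qquad \|E_n[f]\|_2\le\epsilon. \]
   Context: $\mathcal{C}_{2\pi}$ denotes the Banach space of all $2\pi$-periodic continuous complex-valued functions on $\mathbb{R}$ with the supremum norm $\|\cdot\|_\infty$. For $f\in\mathcal{C}_{2\pi}$ its Fourier coefficients are $a_k=\frac{1}{2\pi}\int_{-\pi}^{\pi} f(\theta)e^{-\mathbf{i}k\theta}\,d\theta$, $k\in\mathbb{Z}$. The Toeplitz matrix generated by $f$ is the $n\times n$ matrix $A_n[f]$ whose $(j,k)$ entry is $a_{j-k}$. The optimal circulant preconditioner $c_n[f]$ is the $n\times n$ circulant matrix whose $(j,k)$ entry is $c_{(j-k)\bmod n}$, where $c_k=\frac{(n-k)a_k+k\,a_{k-n}}{n}$ for $0\le k<n$. For a square matrix $X$, $e^{X}=\sum_{m\ge 0}X^m/m!$. $\|\cdot\|_2$ is the spectral norm. *)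

(* Defs.v *)
From Stdlib Require Import Reals Lra ZArith ClassicalEpsilon.
Open Scope R_scope.

Definition C := (R * R)%type.
Definition C0 : C := (0, 0).
Definition C1 : C := (1, 0).
Definition RtoC (x : R) : C := (x, 0).
Definition Cadd (z w : C) : C := (fst z + fst w, snd z + snd w).
Definition Copp (z : C) : C := (- fst z, - snd z).
Definition Csub (z w : C) : C := Cadd z (Copp w).
Definition Cmul (z w : C) : C :=
  (fst z * fst w - snd z * snd w, fst z * snd w + snd z * fst w).
Definition Cscal (r : R) (z : C) : C := (r * fst z, r * snd z).
Definition Cnorm2 (z : C) : R := fst z * fst z + snd z * snd z.

Fixpoint Csum (n : nat) (f : nat -> C) : C :=
  match n with O => C0 | S m => Cadd (Csum m f) (f m) end.
Fixpoint Rsum (n : nat) (f : nat -> R) : R :=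
  match n with O => 0 | S m => Rsum m f + f m end.

Definition Rint (g : R -> R) (a b : R) : R :=
  epsilon (inhabits 0) (fun I => exists pr : Riemann_integrable g a b, RiemannInt pr = I).

(* f = u + i v.  Fourier coefficient
   a_k = 1/(2pi) \int_{-pi}^{pi} f(t) e^{-ikt} dt
       = 1/(2pi) \int (u cos kt + v sin kt) + i/(2pi) \int (v cos kt - u sin kt). *)
Definition fourier (u v : R -> R) (k : Z) : C :=
  ( / (2 * PI) * Rint (fun t => u t * cos (IZR k * t) + v t * sin (IZR k * t)) (- PI) PI,
    / (2 * PI) * Rint (fun t => v t * cos (IZR k * t) - u t * sin (IZR k * t)) (- PI) PI ).

(* ---------- n x n complex matrices: entries (j,k) with j,k < n are meaningful ---------- *)
Definition Mat := nat -> nat -> C.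
Definition Vec := nat -> C.

Definition matadd (X Y : Mat) : Mat := fun j k => Cadd (X j k) (Y j k).
Definition matsub (X Y : Mat) : Mat := fun j k => Csub (X j k) (Y j k).
Definition matmul (n : nat) (X Y : Mat) : Mat :=
  fun j k => Csum n (fun i => Cmul (X j i) (Y i k)).
Definition matid : Mat := fun j k => if Nat.eqb j k then C1 else C0.
Fixpoint matpow (n : nat) (X : Mat) (m : nat) : Mat :=
  match m with O => matid | S p => matmul n (matpow n X p) X end.
Definition matscal (r : R) (X : Mat) : Mat := fun j k => Cscal r (X j k).

Fixpoint exp_partial (n : nat) (X : Mat) (N : nat) : Mat :=
  match N with
  | O => matid
  | S p => matadd (exp_partial n X p) (matscal (/ INR (fact (S p))) (matpow n X (S p)))
  end.

Definition is_matexp (n : nat) (X Y : Mat) : Prop :=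
  forall j k, (j < n)%nat -> (k < n)%nat ->
    Un_cv (fun N => fst (exp_partial n X N j k)) (fst (Y j k)) /\
    Un_cv (fun N => snd (exp_partial n X N j k)) (snd (Y j k)).

Definition matexp (n : nat) (X : Mat) : Mat :=
  epsilon (inhabits (fun _ _ => C0)) (fun Y => is_matexp n X Y).

Definition rank_le (n : nat) (X : Mat) (r : nat) : Prop :=
  exists (U V : Mat), forall j k, (j < n)%nat -> (k < n)%nat ->
    X j k = Csum r (fun i => Cmul (U j i) (V i k)).

Definition vnorm (n : nat) (x : Vec) : R := sqrt (Rsum n (fun i => Cnorm2 (x i))).
Definition matvec (n : nat) (X : Mat) (x : Vec) : Vec :=
  fun j => Csum n (fun i => Cmul (X j i) (x i)).
Definition spec_norm_le (n : nat) (X : Mat) (e : R) : Prop :=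
  forall x : Vec, vnorm n (matvec n X x) <= e * vnorm n x.

Definition toeplitz (u v : R -> R) : Mat :=
  fun j k => fourier u v (Z.of_nat j - Z.of_nat k)%Z.

Definition circ_coef (u v : R -> R) (n k : nat) : C :=
  Cscal (/ INR n)
    (Cadd (Cscal (INR n - INR k) (fourier u v (Z.of_nat k)))
          (Cscal (INR k) (fourier u v (Z.of_nat k - Z.of_nat n)%Z))).

Definition opt_circulant (u v : R -> R) (n : nat) : Mat :=
  fun j k => circ_coef u v n (Z.to_nat (Z.modulo (Z.of_nat j - Z.of_nat k) (Z.of_nat n))).

(* Main.v *)
From Stdlib Require Import Reals Lra Lia Psatz ZArith ClassicalEpsilon.
From Coquelicot Require Import Rbar Hierarchy Continuity Derive RInt AutoDerive RInt_analysis
  Rcomplements Lim_seq.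
Require Import Defs.
Open Scope R_scope.

(** Call a sequence of matrices [X n] essentially small if, for every [eps], it is a matrix of
    rank bounded independently of [n] plus one of norm at most [eps].  Such sequences are stable
    under sums, scaling, products with uniformly bounded sequences and uniform approximation.
    Hence, when [C n - A n] is essentially small and both sequences are bounded, so are all
    [C n ^ m - A n ^ m] (telescoping) and, cutting the exponential series, [exp (C n) - exp (A n)].

    Integrating [|F X - Y|^2 >= 0] over a period bounds the norm of the Toeplitz matrix by the
    supremum of its symbol [F]; the optimal circulant is an average of conjugates of the Toeplitz
    matrix by cyclic permutations, so it obeys the same bound.  By Fejér's theorem it thus
    suffices to treat the symbols [exp (i m t)], where the difference is [- |m| / n] times the
    Toeplitz matrix plus a matrix supported on the first [|m|] rows and columns. *)

(** * Complex numbers and finite sums *)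

Lemma C_eq (z w : C) : fst z = fst w -> snd z = snd w -> z = w.
Proof. destruct z, w; simpl; intros; subst; reflexivity. Qed.

Ltac Ccrush := intros; apply C_eq; unfold Csub, Cadd, Copp, Cmul, Cscal, RtoC, C0, C1; simpl; ring.

Lemma C_ring : ring_theory C0 C1 Cadd Cmul Csub Copp eq.
Proof. constructor; Ccrush. Qed.
Add Ring C_ring : C_ring.

Definition Cconj (z : C) : C := (fst z, - snd z).
Definition cis (t : R) : C := (cos t, sin t).

Lemma Cscal_RtoC r z : Cscal r z = Cmul (RtoC r) z.
Proof. Ccrush. Qed.

Lemma Cnorm2_ge0 z : 0 <= Cnorm2 z.
Proof. unfold Cnorm2; nra. Qed.

Lemma Cnorm2_mul z w : Cnorm2 (Cmul z w) = Cnorm2 z * Cnorm2 w.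
Proof. unfold Cnorm2, Cmul; simpl; ring. Qed.

Lemma Cmul_conj z : Cmul (Cconj z) z = RtoC (Cnorm2 z).
Proof. apply C_eq; unfold Cmul, Cconj, RtoC, Cnorm2; simpl; ring. Qed.

Lemma Cconj_add z w : Cconj (Cadd z w) = Cadd (Cconj z) (Cconj w).
Proof. apply C_eq; unfold Cadd, Cconj; simpl; ring. Qed.

Lemma Cconj_mul z w : Cconj (Cmul z w) = Cmul (Cconj z) (Cconj w).
Proof. apply C_eq; unfold Cmul, Cconj; simpl; ring. Qed.

Lemma cis_add s t : cis (s + t) = Cmul (cis s) (cis t).
Proof. apply C_eq; unfold cis, Cmul; simpl; [rewrite cos_plus|rewrite sin_plus]; ring. Qed.

Lemma Cconj_cis t : Cconj (cis t) = cis (- t).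
Proof. apply C_eq; unfold cis, Cconj; simpl; [rewrite cos_neg|rewrite sin_neg]; reflexivity. Qed.

Lemma cis_0 : cis 0 = C1.
Proof. unfold cis; rewrite cos_0, sin_0; reflexivity. Qed.

Lemma Cnorm2_cis t : Cnorm2 (cis t) = 1.
Proof. unfold Cnorm2, cis; simpl. generalize (sin2_cos2 t); unfold Rsqr; lra. Qed.

Lemma Rsum_ext n f g : (forall i, (i < n)%nat -> f i = g i) -> Rsum n f = Rsum n g.
Proof. induction n; intros H; simpl; auto. rewrite IHn by (intros; apply H; lia). rewrite H by lia; auto. Qed.

Lemma Rsum_ge0 n f : (forall i, (i < n)%nat -> 0 <= f i) -> 0 <= Rsum n f.
Proof. induction n; intros H; simpl; [lra|]. apply Rplus_le_le_0_compat; [apply IHn; intros; apply H; lia|apply H; lia]. Qed.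

Lemma Rsum_scal n c f : Rsum n (fun i => c * f i) = c * Rsum n f.
Proof. induction n; simpl; [ring|rewrite IHn; ring]. Qed.

Lemma Rsum_const n c : Rsum n (fun _ => c) = INR n * c.
Proof. induction n; [simpl; ring|]. rewrite S_INR; simpl; rewrite IHn; ring. Qed.

Lemma Rsum_term_le n f k : (k < n)%nat -> (forall i, (i < n)%nat -> 0 <= f i) -> f k <= Rsum n f.
Proof.
  induction n; intros Hk H; [lia|]; simpl.
  destruct (Nat.eq_dec k n) as [->|Hkn].
  - assert (0 <= Rsum n f) by (apply Rsum_ge0; intros; apply H; lia). lra.
  - assert (f k <= Rsum n f) by (apply IHn; [lia|intros; apply H; lia]).
    assert (0 <= f n) by (apply H; lia). lra.
Qed.

Lemma Csum_ext n f g : (forall i, (i < n)%nat -> f i = g i) -> Csum n f = Csum n g.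
Proof. induction n; intros H; simpl; auto. rewrite IHn by (intros; apply H; lia). rewrite H by lia; auto. Qed.

Lemma Csum_add n f g : Csum n (fun i => Cadd (f i) (g i)) = Cadd (Csum n f) (Csum n g).
Proof. induction n; simpl; [ring|rewrite IHn; ring]. Qed.

Lemma Csum_mul_l n c f : Csum n (fun i => Cmul c (f i)) = Cmul c (Csum n f).
Proof. induction n; simpl; [ring|rewrite IHn; ring]. Qed.

Lemma Csum_mul_r n c f : Csum n (fun i => Cmul (f i) c) = Cmul (Csum n f) c.
Proof. induction n; simpl; [ring|rewrite IHn; ring]. Qed.

Lemma Csum_zero n : Csum n (fun _ => C0) = C0.
Proof. induction n; simpl; [auto|rewrite IHn; ring]. Qed.

Lemma Csum_exchange m n (f : nat -> nat -> C) :
  Csum m (fun i => Csum n (fun j => f i j)) = Csum n (fun j => Csum m (fun i => f i j)).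
Proof.
  induction m; simpl.
  - now rewrite Csum_zero.
  - rewrite IHm, <- Csum_add; reflexivity.
Qed.

Lemma Csum_split m n f : Csum (m + n) f = Cadd (Csum m f) (Csum n (fun i => f (m + i)%nat)).
Proof.
  induction n; simpl.
  - rewrite Nat.add_0_r; ring.
  - rewrite Nat.add_succ_r; simpl; rewrite IHn; ring.
Qed.

Lemma Csum_const n c : Csum n (fun _ => c) = Cscal (INR n) c.
Proof.
  induction n; [apply C_eq; simpl; ring|]. simpl Csum. rewrite IHn, S_INR. Ccrush.
Qed.

Lemma fst_Csum n f : fst (Csum n f) = Rsum n (fun i => fst (f i)).
Proof. induction n; simpl; [|rewrite IHn]; reflexivity. Qed.

Lemma snd_Csum n f : snd (Csum n f) = Rsum n (fun i => snd (f i)).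
Proof. induction n; simpl; [|rewrite IHn]; reflexivity. Qed.

Lemma Cconj_Csum n f : Cconj (Csum n f) = Csum n (fun i => Cconj (f i)).
Proof.
  induction n; simpl; [|rewrite Cconj_add, IHn]; [|reflexivity].
  apply C_eq; simpl; ring.
Qed.

Lemma Csum_single n f k :
  (k < n)%nat -> (forall i, (i < n)%nat -> i <> k -> f i = C0) -> Csum n f = f k.
Proof.
  intros Hk H.
  replace n with (k + S (n - S k))%nat by lia.
  rewrite Csum_split.
  rewrite (Csum_ext k f (fun _ => C0)) by (intros; apply H; lia).
  replace (Csum (S (n - S k)) (fun i => f (k + i)%nat)) with (f k).
  - rewrite Csum_zero; ring.
  - replace (S (n - S k)) with (1 + (n - S k))%nat by lia. rewrite Csum_split.
    rewrite (Csum_ext (n - S k) _ (fun _ => C0)) by (intros; apply H; lia).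
    rewrite Csum_zero; simpl. rewrite Nat.add_0_r; ring.
Qed.

(** Moving a window of length [n] by one step drops [f s] and gains [f (n + s)], which are equal by
    periodicity. *)
Lemma Csum_rot n s f :
  (forall i, f (i + n)%nat = f i) -> Csum n (fun i => f (i + s)%nat) = Csum n f.
Proof.
  intros Hper.
  (* Both sides are [g 0 + ... + g m], with the first or the last term split off. *)
  assert (Hshift : forall m g, Cadd (Csum m (fun i => g (S i))) (g 0%nat) = Cadd (Csum m g) (g m)).
  { induction m; intros g; simpl; [ring|].
    replace (Cadd (Cadd (Csum m (fun i => g (S i))) (g (S m))) (g 0%nat))
      with (Cadd (Cadd (Csum m (fun i => g (S i))) (g 0%nat)) (g (S m))) by ring.
    rewrite IHm; ring. }
  induction s.
  - apply Csum_ext; intros; now rewrite Nat.add_0_r.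
  - rewrite <- IHs.
    generalize (Hshift n (fun i => f (i + s)%nat)); simpl.
    replace (f (n + s)%nat) with (f s) by (rewrite <- Hper; f_equal; lia).
    intros H.
    rewrite (Csum_ext n _ (fun i => f (S (i + s)))) by (intros; f_equal; lia).
    replace (Csum n (fun i => f (i + s)%nat))
      with (Csub (Cadd (Csum n (fun i => f (i + s)%nat)) (f s)) (f s)) by ring.
    rewrite <- H; ring.
Qed.

Lemma Csum_rot_mod n s f : (0 < n)%nat ->
  Csum n (fun i => f ((i + s) mod n)%nat) = Csum n f.
Proof.
  intros Hn.
  rewrite (Csum_rot n s (fun i => f (i mod n)%nat)).
  - apply Csum_ext; intros; now rewrite Nat.mod_small.
  - intros i. f_equal. rewrite <- (Nat.mul_1_l n) at 1. apply Nat.Div0.mod_add.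
Qed.

Lemma Rsum_rot_mod n s f : (0 < n)%nat ->
  Rsum n (fun i => f ((i + s) mod n)%nat) = Rsum n f.
Proof.
  intros Hn.
  generalize (f_equal fst (Csum_rot_mod n s (fun i => RtoC (f i)) Hn)).
  rewrite !fst_Csum; simpl; auto.
Qed.

(** * Norm and rank estimates *)

Lemma vnorm_ge0 n x : 0 <= vnorm n x.
Proof. apply sqrt_pos. Qed.

Lemma vnorm_sqr n x : vnorm n x * vnorm n x = Rsum n (fun i => Cnorm2 (x i)).
Proof. apply sqrt_sqrt, Rsum_ge0; intros; apply Cnorm2_ge0. Qed.

Lemma vnorm_ext n x y : (forall i, (i < n)%nat -> x i = y i) -> vnorm n x = vnorm n y.
Proof. intros H; unfold vnorm; f_equal; apply Rsum_ext; intros; now rewrite H. Qed.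

(** Triangle inequality in the plane. It serves twice in [vnorm_add]: for the modulus of a sum of
    complex numbers and for the induction on the dimension. *)
Lemma sqrt_minkowski a b c d :
  sqrt ((a + b) * (a + b) + (c + d) * (c + d)) <= sqrt (a * a + c * c) + sqrt (b * b + d * d).
Proof.
  assert (Hp := sqrt_pos (a * a + c * c)). assert (Hq := sqrt_pos (b * b + d * d)).
  assert (Hp2 := sqrt_sqrt (a * a + c * c) ltac:(nra)).
  assert (Hq2 := sqrt_sqrt (b * b + d * d) ltac:(nra)).
  set (p := sqrt (a * a + c * c)) in *. set (q := sqrt (b * b + d * d)) in *.
  (* Cauchy-Schwarz, from [(a * d - b * c)^2 >= 0]. *)
  assert (Hcs : a * b + c * d <= p * q).
  { apply Rsqr_incr_0_var; [|nra]. unfold Rsqr.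
    replace (p * q * (p * q)) with ((p * p) * (q * q)) by ring. rewrite Hp2, Hq2.
    generalize (Rle_0_sqr (a * d - b * c)); unfold Rsqr; nra. }
  rewrite <- (sqrt_square (p + q)) by lra. apply sqrt_le_1_alt. nra.
Qed.

(** By [Hrec], the norm in dimension [m + 1] is the planar norm of the pair formed by the norm of
    the first [m] coordinates and the modulus of the last one. *)
Lemma vnorm_add n x y : vnorm n (fun i => Cadd (x i) (y i)) <= vnorm n x + vnorm n y.
Proof.
  assert (Hrec : forall m z, vnorm (S m) z = sqrt (vnorm m z * vnorm m z + Cnorm2 (z m))).
  { intros; rewrite vnorm_sqr; reflexivity. }
  induction n.
  - unfold vnorm; simpl; rewrite sqrt_0; lra.
  - rewrite !Hrec.
    assert (Hn2 : forall z, Cnorm2 z = sqrt (Cnorm2 z) * sqrt (Cnorm2 z)).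
    { intros; rewrite sqrt_sqrt; auto using Cnorm2_ge0. }
    rewrite (Hn2 (x n)), (Hn2 (y n)).
    eapply Rle_trans; [|apply sqrt_minkowski]. apply sqrt_le_1_alt.
    assert (H0 := vnorm_ge0 n (fun i => Cadd (x i) (y i))).
    assert (Cnorm2 (Cadd (x n) (y n)) <= (sqrt (Cnorm2 (x n)) + sqrt (Cnorm2 (y n))) * (sqrt (Cnorm2 (x n)) + sqrt (Cnorm2 (y n)))).
    { rewrite (Hn2 (Cadd (x n) (y n))).
      assert (H1 := sqrt_minkowski (fst (x n)) (fst (y n)) (snd (x n)) (snd (y n))).
      apply Rmult_le_compat; try apply sqrt_pos; exact H1. }
    nra.
Qed.

Lemma vnorm_mul n c x : vnorm n (fun i => Cmul c (x i)) = sqrt (Cnorm2 c) * vnorm n x.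
Proof.
  unfold vnorm. rewrite <- sqrt_mult; auto using Cnorm2_ge0.
  - f_equal. rewrite <- Rsum_scal. apply Rsum_ext; intros; apply Cnorm2_mul.
  - apply Rsum_ge0; intros; apply Cnorm2_ge0.
Qed.

Definition cmatscal (c : C) (X : Mat) : Mat := fun j k => Cmul c (X j k).
Definition meq (n : nat) (X Y : Mat) : Prop :=
  forall j k, (j < n)%nat -> (k < n)%nat -> X j k = Y j k.

Lemma matscal_cmatscal r X j k : matscal r X j k = cmatscal (RtoC r) X j k.
Proof. apply Cscal_RtoC. Qed.

Lemma matvec_ext n X Y x j :
  meq n X Y -> (j < n)%nat -> matvec n X x j = matvec n Y x j.
Proof. intros H Hj; apply Csum_ext; intros; now rewrite H. Qed.

Lemma spec_norm_ext n X Y e : meq n X Y -> spec_norm_le n X e -> spec_norm_le n Y e.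
Proof.
  intros H HX x. rewrite <- (vnorm_ext n (matvec n X x)); auto.
  intros; now apply matvec_ext.
Qed.

Lemma spec_norm_weaken n X e e' : e <= e' -> spec_norm_le n X e -> spec_norm_le n X e'.
Proof.
  intros H HX x. eapply Rle_trans; [apply HX|].
  apply Rmult_le_compat_r; auto using vnorm_ge0.
Qed.

Lemma spec_norm_add n X Y e e' :
  spec_norm_le n X e -> spec_norm_le n Y e' -> spec_norm_le n (matadd X Y) (e + e').
Proof.
  intros HX HY x.
  rewrite (vnorm_ext n _ (fun j => Cadd (matvec n X x j) (matvec n Y x j))).
  - eapply Rle_trans; [apply vnorm_add|]. generalize (HX x) (HY x); lra.
  - intros; unfold matvec, matadd. rewrite <- Csum_add. apply Csum_ext; intros; ring.
Qed.

Lemma spec_norm_cmatscal n c X e :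
  spec_norm_le n X e -> spec_norm_le n (cmatscal c X) (sqrt (Cnorm2 c) * e).
Proof.
  intros HX x.
  rewrite (vnorm_ext n _ (fun j => Cmul c (matvec n X x j))).
  - rewrite vnorm_mul, Rmult_assoc. apply Rmult_le_compat_l; [apply sqrt_pos|apply HX].
  - intros; unfold matvec, cmatscal. rewrite <- Csum_mul_l. apply Csum_ext; intros; ring.
Qed.

Lemma Cnorm2_RtoC r : sqrt (Cnorm2 (RtoC r)) = Rabs r.
Proof.
  unfold Cnorm2, RtoC; simpl. rewrite Rmult_0_l, Rplus_0_r. apply sqrt_Rsqr_abs.
Qed.

Lemma spec_norm_matscal n r X e :
  spec_norm_le n X e -> spec_norm_le n (matscal r X) (Rabs r * e).
Proof.
  intros HX. apply (spec_norm_ext n (cmatscal (RtoC r) X)).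
  - intros j k _ _; symmetry; apply matscal_cmatscal.
  - rewrite <- Cnorm2_RtoC. now apply spec_norm_cmatscal.
Qed.

Lemma spec_norm_sub n X Y e e' :
  spec_norm_le n X e -> spec_norm_le n Y e' -> spec_norm_le n (matsub X Y) (e + e').
Proof.
  intros HX HY. apply (spec_norm_ext n (matadd X (matscal (-1) Y))).
  - intros j k _ _. unfold matadd, matscal, matsub, Csub. f_equal. Ccrush.
  - apply spec_norm_add; auto. replace e' with (Rabs (-1) * e').
    + now apply spec_norm_matscal.
    + rewrite Rabs_left by lra; ring.
Qed.

Lemma matvec_matmul n X Y x j : matvec n (matmul n X Y) x j = matvec n X (matvec n Y x) j.
Proof.
  unfold matvec, matmul.
  rewrite (Csum_ext n _ (fun i => Csum n (fun l => Cmul (Cmul (X j l) (Y l i)) (x i))))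
    by (intros; now rewrite Csum_mul_r).
  rewrite Csum_exchange. apply Csum_ext; intros.
  rewrite <- Csum_mul_l. apply Csum_ext; intros; ring.
Qed.

Lemma spec_norm_mul n X Y e e' : 0 <= e ->
  spec_norm_le n X e -> spec_norm_le n Y e' -> spec_norm_le n (matmul n X Y) (e * e').
Proof.
  intros He HX HY x.
  rewrite (vnorm_ext n _ (matvec n X (matvec n Y x))) by (intros; apply matvec_matmul).
  eapply Rle_trans; [apply HX|]. rewrite Rmult_assoc. apply Rmult_le_compat_l; auto.
Qed.

Lemma spec_norm_id n : spec_norm_le n matid 1.
Proof.
  intros x. rewrite Rmult_1_l. apply Req_le, vnorm_ext. intros j Hj.
  unfold matvec, matid. rewrite (Csum_single n _ j); auto.
  - rewrite Nat.eqb_refl; ring.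
  - intros i _ Hi. destruct (Nat.eqb_spec j i); [congruence|ring].
Qed.

Lemma spec_norm_zero n : spec_norm_le n (fun _ _ => C0) 0.
Proof.
  intros x. rewrite Rmult_0_l. apply Req_le. unfold vnorm.
  rewrite (Rsum_ext n _ (fun _ => 0)).
  - rewrite Rsum_const, Rmult_0_r. apply sqrt_0.
  - intros. unfold matvec. rewrite (Csum_ext n _ (fun _ => C0)) by (intros; ring).
    rewrite Csum_zero. unfold Cnorm2; simpl; ring.
Qed.

Lemma spec_norm_pow n X e m : 0 <= e -> spec_norm_le n X e -> spec_norm_le n (matpow n X m) (e ^ m).
Proof.
  intros He HX. induction m; simpl; [apply spec_norm_id|].
  rewrite Rmult_comm. apply spec_norm_mul; auto using pow_le.
Qed.

Lemma spec_norm_Csum n m (X : nat -> Mat) e :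
  (forall s, (s < m)%nat -> spec_norm_le n (X s) e) ->
  spec_norm_le n (fun j k => Csum m (fun s => X s j k)) (INR m * e).
Proof.
  induction m; intros H.
  - rewrite Rmult_0_l. apply spec_norm_zero.
  - rewrite S_INR. replace ((INR m + 1) * e) with (INR m * e + e) by ring.
    apply (spec_norm_add n (fun j k => Csum m (fun s => X s j k)) (X m)); auto.
Qed.

(** Applying [X] to the [k]-th basis vector gives column [k], and an entry is at most the norm of
    its column. This turns norm estimates into entrywise convergence. *)
Lemma spec_norm_entry n X e j k : 0 <= e ->
  spec_norm_le n X e -> (j < n)%nat -> (k < n)%nat -> Cnorm2 (X j k) <= e * e.
Proof.
  intros He HX Hj Hk.
  set (x := fun i => if Nat.eqb i k then C1 else C0).
  assert (Hx : vnorm n x <= 1).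
  { unfold vnorm. rewrite <- sqrt_1. apply sqrt_le_1_alt.
    assert (H := Csum_single n (fun i => RtoC (Cnorm2 (x i))) k Hk).
    apply (f_equal fst) in H.
    - rewrite fst_Csum in H. simpl in H. rewrite H. unfold x.
      rewrite Nat.eqb_refl. unfold Cnorm2; simpl; lra.
    - intros i _ Hi. unfold x. destruct (Nat.eqb_spec i k); [congruence|].
      unfold RtoC, Cnorm2; simpl. unfold C0; f_equal; ring. }
  assert (Hv : matvec n X x j = X j k).
  { unfold matvec. rewrite (Csum_single n _ k Hk).
    - unfold x; rewrite Nat.eqb_refl; ring.
    - intros i _ Hi. unfold x. destruct (Nat.eqb_spec i k); [congruence|ring]. }
  assert (H1 : Cnorm2 (X j k) <= vnorm n (matvec n X x) * vnorm n (matvec n X x)).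
  { rewrite vnorm_sqr, <- Hv.
    apply (Rsum_term_le n (fun i => Cnorm2 (matvec n X x i))); auto; intros; apply Cnorm2_ge0. }
  assert (H2 := HX x). assert (H3 := vnorm_ge0 n x). assert (H4 := vnorm_ge0 n (matvec n X x)).
  assert (vnorm n (matvec n X x) <= e) by nra. nra.
Qed.

Lemma rank_le_ext n X Y r : meq n X Y -> rank_le n X r -> rank_le n Y r.
Proof. intros H (U & V & HX). exists U, V. intros j k Hj Hk. rewrite <- H; auto. Qed.

(** The factors are concatenated: [U] and [U'] side by side, [V] above [V']. *)
Lemma rank_le_add n X Y r s :
  rank_le n X r -> rank_le n Y s -> rank_le n (matadd X Y) (r + s).
Proof.
  intros (U & V & HX) (U' & V' & HY).
  exists (fun j i => if Nat.ltb i r then U j i else U' j (i - r)%nat),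
         (fun i k => if Nat.ltb i r then V i k else V' (i - r)%nat k).
  intros j k Hj Hk. rewrite Csum_split. unfold matadd. rewrite HX, HY by auto. f_equal.
  - apply Csum_ext; intros i Hi. destruct (Nat.ltb_spec i r); [auto|lia].
  - apply Csum_ext; intros i Hi. destruct (Nat.ltb_spec (r + i) r); [lia|].
    now replace (r + i - r)%nat with i by lia.
Qed.

Lemma rank_le_zero n r : rank_le n (fun _ _ => C0) r.
Proof.
  exists (fun _ _ => C0), (fun _ _ => C0). intros.
  rewrite (Csum_ext r _ (fun _ => C0)) by (intros; ring). now rewrite Csum_zero.
Qed.

Lemma rank_le_weaken n X r s : (r <= s)%nat -> rank_le n X r -> rank_le n X s.
Proof.
  intros Hrs H. replace s with (r + (s - r))%nat by lia.
  apply (rank_le_ext n (matadd X (fun _ _ => C0))).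
  - intros j k _ _. unfold matadd; ring.
  - apply rank_le_add; auto using rank_le_zero.
Qed.

Lemma rank_le_cmatscal n c X r : rank_le n X r -> rank_le n (cmatscal c X) r.
Proof.
  intros (U & V & HX). exists (fun j i => Cmul c (U j i)), V. intros j k Hj Hk.
  unfold cmatscal. rewrite HX by auto. rewrite <- Csum_mul_l. apply Csum_ext; intros; ring.
Qed.

Lemma rank_le_mul_l n X Y r : rank_le n Y r -> rank_le n (matmul n X Y) r.
Proof.
  intros (U & V & HY). exists (matmul n X U), V. intros j k Hj Hk. unfold matmul.
  rewrite (Csum_ext n _ (fun i => Csum r (fun l => Cmul (X j i) (Cmul (U i l) (V l k))))).
  - rewrite Csum_exchange. apply Csum_ext; intros l Hl. rewrite <- Csum_mul_r.
    apply Csum_ext; intros; ring.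
  - intros i Hi. now rewrite HY, Csum_mul_l.
Qed.

Lemma rank_le_mul_r n X Y r : rank_le n X r -> rank_le n (matmul n X Y) r.
Proof.
  intros (U & V & HX). exists U, (matmul n V Y). intros j k Hj Hk. unfold matmul.
  rewrite (Csum_ext n _ (fun i => Csum r (fun l => Cmul (Cmul (U j l) (V l i)) (Y i k)))).
  - rewrite Csum_exchange. apply Csum_ext; intros l Hl. rewrite <- Csum_mul_l.
    apply Csum_ext; intros; ring.
  - intros i Hi. now rewrite HX, Csum_mul_r.
Qed.

(** The first [r] rows, and what remains of the first [r] columns, each factor through a space of
    dimension [r]. *)
Lemma rank_le_border n X r :
  (forall j k, (j < n)%nat -> (k < n)%nat -> (r <= j)%nat -> (r <= k)%nat -> X j k = C0) ->
  rank_le n X (r + r).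
Proof.
  intros H.
  apply (rank_le_ext n (matadd (fun j k => if Nat.ltb j r then X j k else C0)
                              (fun j k => if Nat.ltb j r then C0 else
                                            if Nat.ltb k r then X j k else C0))).
  - intros j k Hj Hk. unfold matadd.
    destruct (Nat.ltb_spec j r); [ring|]. destruct (Nat.ltb_spec k r); [ring|].
    rewrite H by auto; ring.
  - apply rank_le_add.
    (* The inner index stops at [r], so [matid] acts here as the identity block of size [r] padded
       with zero rows. *)
    + exists matid, X. intros j k Hj Hk. destruct (Nat.ltb_spec j r).
      * rewrite (Csum_single r _ j); auto.
        -- unfold matid; rewrite Nat.eqb_refl; ring.
        -- intros i _ Hi. unfold matid. destruct (Nat.eqb_spec j i); [congruence|ring].
      * rewrite (Csum_ext r _ (fun _ => C0)); [now rewrite Csum_zero|].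
        intros i Hi. unfold matid. destruct (Nat.eqb_spec j i); [lia|ring].
    + exists (fun j i => if Nat.ltb j r then C0 else X j i), matid. intros j k Hj Hk.
      destruct (Nat.ltb_spec j r).
      * rewrite (Csum_ext r _ (fun _ => C0)); [now rewrite Csum_zero|]. intros; ring.
      * destruct (Nat.ltb_spec k r).
        -- rewrite (Csum_single r _ k); auto.
           ++ unfold matid; rewrite Nat.eqb_refl; ring.
           ++ intros i _ Hi. unfold matid. destruct (Nat.eqb_spec i k); [congruence|ring].
        -- rewrite (Csum_ext r _ (fun _ => C0)); [now rewrite Csum_zero|].
           intros i Hi. unfold matid. destruct (Nat.eqb_spec i k); [lia|ring].
Qed.

(** * Sequences of matrices that are small up to bounded rank *)

Definition ess_small (X : nat -> Mat) : Prop :=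
  forall eps, 0 < eps -> exists N r : nat, forall n, (N < n)%nat ->
    exists Rn En : Mat, meq n (X n) (matadd Rn En) /\ rank_le n Rn r /\ spec_norm_le n En eps.

Lemma ess_small_ext X Y : (forall n, meq n (X n) (Y n)) -> ess_small X -> ess_small Y.
Proof.
  intros H HX eps He. destruct (HX eps He) as (N & r & HN). exists N, r. intros n Hn.
  destruct (HN n Hn) as (Rn & En & H1 & H2). exists Rn, En. split; auto.
  intros j k Hj Hk. rewrite <- H by auto. now apply H1.
Qed.

Lemma ess_small_add X Y :
  ess_small X -> ess_small Y -> ess_small (fun n => matadd (X n) (Y n)).
Proof.
  intros HX HY eps He.
  destruct (HX (eps / 2)) as (N & r & HN); [lra|].
  destruct (HY (eps / 2)) as (N' & r' & HN'); [lra|].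
  exists (Nat.max N N'), (r + r')%nat. intros n Hn.
  destruct (HN n) as (R1 & E1 & H1 & HR1 & HE1); [lia|].
  destruct (HN' n) as (R2 & E2 & H2 & HR2 & HE2); [lia|].
  exists (matadd R1 R2), (matadd E1 E2). repeat split.
  - intros j k Hj Hk. generalize (H1 j k Hj Hk) (H2 j k Hj Hk).
    unfold matadd; intros -> ->; ring.
  - now apply rank_le_add.
  - replace eps with (eps / 2 + eps / 2) by field. now apply spec_norm_add.
Qed.

Lemma ess_small_zero : ess_small (fun _ _ _ => C0).
Proof.
  intros eps He. exists O, O. intros n _. exists (fun _ _ => C0), (fun _ _ => C0). repeat split.
  - intros j k _ _; unfold matadd; ring.
  - apply rank_le_zero.
  - apply (spec_norm_weaken n _ 0); [lra|apply spec_norm_zero].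
Qed.

Lemma ess_small_cmatscal c X : ess_small X -> ess_small (fun n => cmatscal c (X n)).
Proof.
  intros HX eps He. set (s := sqrt (Cnorm2 c)).
  assert (Hs : 0 <= s) by apply sqrt_pos.
  (* Dividing by [s + 1] instead of [s] also covers [c = 0]. *)
  destruct (HX (eps / (s + 1))) as (N & r & HN); [apply Rdiv_lt_0_compat; lra|].
  exists N, r. intros n Hn. destruct (HN n Hn) as (R1 & E1 & H1 & HR1 & HE1).
  exists (cmatscal c R1), (cmatscal c E1). repeat split.
  - intros j k Hj Hk. generalize (H1 j k Hj Hk). unfold cmatscal, matadd; intros ->; ring.
  - now apply rank_le_cmatscal.
  - apply (spec_norm_weaken n _ (s * (eps / (s + 1)))); [|now apply spec_norm_cmatscal].
    apply Rmult_le_reg_r with (s + 1); [lra|]. field_simplify; nra.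
Qed.

Lemma ess_small_Csum m (X : nat -> nat -> Mat) :
  (forall i, (i < m)%nat -> ess_small (X i)) ->
  ess_small (fun n j k => Csum m (fun i => X i n j k)).
Proof.
  induction m; intros H; [apply ess_small_zero|].
  apply (ess_small_add (fun n j k => Csum m (fun i => X i n j k)) (X m)); auto.
Qed.

Lemma ess_small_mul_l X Y L : 0 <= L ->
  (forall n, (0 < n)%nat -> spec_norm_le n (Y n) L) ->
  ess_small X -> ess_small (fun n => matmul n (Y n) (X n)).
Proof.
  intros HL HY HX eps He.
  destruct (HX (eps / (L + 1))) as (N & r & HN); [apply Rdiv_lt_0_compat; lra|].
  exists N, r. intros n Hn. destruct (HN n Hn) as (R1 & E1 & H1 & HR1 & HE1).
  exists (matmul n (Y n) R1), (matmul n (Y n) E1). repeat split.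
  - intros j k Hj Hk. unfold matadd, matmul. rewrite <- Csum_add. apply Csum_ext; intros i Hi.
    rewrite H1 by auto. unfold matadd; ring.
  - now apply rank_le_mul_l.
  - apply (spec_norm_weaken n _ (L * (eps / (L + 1)))).
    + apply Rmult_le_reg_r with (L + 1); [lra|]. field_simplify; nra.
    + apply spec_norm_mul; auto. apply HY; lia.
Qed.

Lemma ess_small_mul_r X Y L : 0 <= L ->
  (forall n, (0 < n)%nat -> spec_norm_le n (Y n) L) ->
  ess_small X -> ess_small (fun n => matmul n (X n) (Y n)).
Proof.
  intros HL HY HX eps He.
  assert (He' : 0 < eps / (L + 1)) by (apply Rdiv_lt_0_compat; lra).
  destruct (HX _ He') as (N & r & HN).
  exists N, r. intros n Hn. destruct (HN n Hn) as (R1 & E1 & H1 & HR1 & HE1).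
  exists (matmul n R1 (Y n)), (matmul n E1 (Y n)). repeat split.
  - intros j k Hj Hk. unfold matadd, matmul. rewrite <- Csum_add. apply Csum_ext; intros i Hi.
    rewrite H1 by auto. unfold matadd; ring.
  - now apply rank_le_mul_r.
  - apply (spec_norm_weaken n _ (eps / (L + 1) * L)).
    + apply Rmult_le_reg_r with (L + 1); [lra|]. field_simplify; nra.
    + apply spec_norm_mul; auto; [lra|]. apply HY; lia.
Qed.

(** The approximation error joins the small-norm part and leaves the rank alone; [Y] may depend on
    [eps]. It is used for truncated exponentials and for Fejér polynomials. *)
Lemma ess_small_approx X :
  (forall eps, 0 < eps -> exists Y, ess_small Y /\
     forall n, (0 < n)%nat -> spec_norm_le n (matsub (X n) (Y n)) eps) -> ess_small X.
Proof.
  intros H eps He.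
  destruct (H (eps / 2)) as (Y & HY & HXY); [lra|].
  destruct (HY (eps / 2)) as (N & r & HN); [lra|].
  exists N, r. intros n Hn. destruct (HN n Hn) as (R1 & E1 & H1 & HR1 & HE1).
  exists R1, (matadd E1 (matsub (X n) (Y n))). repeat split; auto.
  - intros j k Hj Hk. generalize (H1 j k Hj Hk). unfold matadd, matsub; intros ->; ring.
  - replace eps with (eps / 2 + eps / 2) by field. apply spec_norm_add; auto. apply HXY; lia.
Qed.

(** * Matrix exponentials *)

(** The bound is a block of the scalar series of [exp L]. It depends on neither [n] nor [X] beyond
    the bound [L], which makes the truncation uniform. *)
Lemma spec_norm_exp_partial_tail n X L N p : 0 <= L -> spec_norm_le n X L ->
  spec_norm_le n (matsub (exp_partial n X (N + p)) (exp_partial n X N))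
    (Rsum p (fun i => / INR (fact (S (N + i))) * L ^ S (N + i))).
Proof.
  intros HL HX. induction p.
  - rewrite Nat.add_0_r. apply (spec_norm_ext n (fun _ _ => C0)), spec_norm_zero.
    intros j k _ _; unfold matsub; ring.
  - rewrite Nat.add_succ_r. cbn [Rsum].
    apply (spec_norm_ext n (matadd (matsub (exp_partial n X (N + p)) (exp_partial n X N))
             (matscal (/ INR (fact (S (N + p)))) (matpow n X (S (N + p)))))).
    + intros j k _ _. cbn [exp_partial]. unfold matadd, matsub; ring.
    + apply spec_norm_add; auto.
      rewrite <- (Rabs_right (/ INR (fact (S (N + p))))) at 2.
      * apply spec_norm_matscal, spec_norm_pow; auto.
      * apply Rle_ge, Rlt_le, Rinv_0_lt_compat, lt_0_INR, lt_O_fact.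
Qed.

(** The block is a difference of two partial sums of [exp L], so the Cauchy criterion applies. *)
Lemma exp_series_tail L eps : 0 <= L -> 0 < eps -> exists N, forall M p, (N <= M)%nat ->
  Rsum p (fun i => / INR (fact (S (M + i))) * L ^ S (M + i)) <= eps.
Proof.
  intros HL He.
  assert (Hcv : Un_cv (fun N => sum_f_R0 (fun i => / INR (fact i) * L ^ i) N) (exp L)).
  { unfold exp. destruct (exist_exp L) as [l Hl]. exact Hl. }
  destruct (CV_Cauchy _ (exist _ _ Hcv) eps He) as [N HN].
  exists N. intros M p HM.
  assert (Heq : Rsum p (fun i => / INR (fact (S (M + i))) * L ^ S (M + i))
     = sum_f_R0 (fun i => / INR (fact i) * L ^ i) (M + p) - sum_f_R0 (fun i => / INR (fact i) * L ^ i) M).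
  { induction p.
    - rewrite Nat.add_0_r; simpl; ring.
    - rewrite Nat.add_succ_r. cbn [Rsum]. rewrite IHp, tech5. ring. }
  rewrite Heq. eapply Rle_trans; [apply Rle_abs|]. apply Rlt_le. apply HN; lia.
Qed.

(** For fixed [x], the squared norm of [Xs m x] is a polynomial in the entries of [Xs m], so it
    converges and the bound passes to the limit. Working with squares avoids limits of square
    roots. *)
Lemma spec_norm_lim n (Xs : nat -> Mat) (Y : Mat) e : 0 <= e ->
  (forall m, spec_norm_le n (Xs m) e) ->
  (forall j k, (j < n)%nat -> (k < n)%nat ->
     is_lim_seq (fun m => fst (Xs m j k)) (fst (Y j k)) /\
     is_lim_seq (fun m => snd (Xs m j k)) (snd (Y j k))) ->
  spec_norm_le n Y e.
Proof.
  intros He HX Hlim x.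
  assert (HR : forall p (F : nat -> nat -> R) (G : nat -> R),
     (forall i, (i < p)%nat -> is_lim_seq (fun m => F m i) (G i)) ->
     is_lim_seq (fun m => Rsum p (F m)) (Rsum p G)).
  { induction p; intros F G H; simpl; [apply is_lim_seq_const|].
    apply is_lim_seq_plus'; [apply IHp; intros|]; apply H; lia. }
  assert (Hv : forall j, (j < n)%nat ->
     is_lim_seq (fun m => fst (matvec n (Xs m) x j)) (fst (matvec n Y x j)) /\
     is_lim_seq (fun m => snd (matvec n (Xs m) x j)) (snd (matvec n Y x j))).
  { intros j Hj. unfold matvec. rewrite fst_Csum, snd_Csum. split.
    - apply is_lim_seq_ext with (fun m => Rsum n (fun i => fst (Cmul (Xs m j i) (x i)))).
      + intros; now rewrite fst_Csum.
      + apply (HR n (fun m i => fst (Cmul (Xs m j i) (x i)))). intros i Hi.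
        destruct (Hlim j i Hj Hi). simpl.
        apply is_lim_seq_minus'; apply is_lim_seq_mult'; auto using is_lim_seq_const.
    - apply is_lim_seq_ext with (fun m => Rsum n (fun i => snd (Cmul (Xs m j i) (x i)))).
      + intros; now rewrite snd_Csum.
      + apply (HR n (fun m i => snd (Cmul (Xs m j i) (x i)))). intros i Hi.
        destruct (Hlim j i Hj Hi). simpl.
        apply is_lim_seq_plus'; apply is_lim_seq_mult'; auto using is_lim_seq_const. }
  assert (Hsq : is_lim_seq (fun m => vnorm n (matvec n (Xs m) x) * vnorm n (matvec n (Xs m) x))
                 (vnorm n (matvec n Y x) * vnorm n (matvec n Y x))).
  { rewrite vnorm_sqr.
    apply is_lim_seq_ext with (fun m => Rsum n (fun i => Cnorm2 (matvec n (Xs m) x i))).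
    - intros; now rewrite vnorm_sqr.
    - apply (HR n (fun m i => Cnorm2 (matvec n (Xs m) x i))). intros i Hi.
      destruct (Hv i Hi). unfold Cnorm2.
      apply is_lim_seq_plus'; apply is_lim_seq_mult'; auto. }
  assert (Hx := vnorm_ge0 n x).
  apply Rsqr_incr_0_var; [|nra]. unfold Rsqr.
  refine (is_lim_seq_le _ _ (Finite _) (Finite _) _ Hsq (is_lim_seq_const _)).
  intros m. simpl. apply Rmult_le_compat; try apply vnorm_ge0; apply HX.
Qed.

(** Since [matexp] is a choice, a limit of the partial sums has to be exhibited. Each entry is a
    Cauchy sequence by the tail bound and [spec_norm_entry]. *)
Lemma matexp_correct n X L : 0 <= L -> spec_norm_le n X L -> is_matexp n X (matexp n X).
Proof.
  intros HL HX. unfold matexp. apply epsilon_spec.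
  (* [pr] stands for the real or the imaginary part; only compatibility with differences and
     domination by the modulus matter. *)
  assert (Hcauchy : forall j k, (j < n)%nat -> (k < n)%nat -> forall (pr : C -> R),
     (forall z w, pr (Csub z w) = pr z - pr w) -> (forall z, pr z * pr z <= Cnorm2 z) ->
     Cauchy_crit (fun N => pr (exp_partial n X N j k))).
  { intros j k Hj Hk pr Hpr Hpr2 eps He.
    destruct (exp_series_tail L (eps / 3) HL) as [N HN]; [lra|].
    exists N.
    assert (Hb : forall p, (p >= N)%nat -> Rabs (pr (exp_partial n X p j k) - pr (exp_partial n X N j k)) <= eps / 3).
    { intros p Hp. rewrite <- Hpr.
      assert (H := spec_norm_exp_partial_tail n X L N (p - N) HL HX).
      replace (N + (p - N))%nat with p in H by lia.
      apply (spec_norm_weaken _ _ _ (eps / 3)) in H; [|apply HN; lia].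
      apply (spec_norm_entry n _ _ j k) in H; auto; [|lra].
      rewrite <- (Rabs_right (eps / 3)) by lra. apply Rsqr_le_abs_0. unfold Rsqr.
      eapply Rle_trans; [apply Hpr2|exact H]. }
    intros p q Hp Hq. unfold Rdist.
    replace (pr (exp_partial n X p j k) - pr (exp_partial n X q j k)) with
      ((pr (exp_partial n X p j k) - pr (exp_partial n X N j k))
       - (pr (exp_partial n X q j k) - pr (exp_partial n X N j k))) by ring.
    eapply Rle_lt_trans; [apply Rabs_triang|]. rewrite Rabs_Ropp.
    generalize (Hb p Hp) (Hb q Hq); lra. }
  (* The index bounds sit under the existential, so that a value exists for every [j] and [k] and a
     whole matrix can be chosen entry by entry. *)
  assert (Hlim : forall j k, exists z : C, (j < n)%nat -> (k < n)%nat ->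
     Un_cv (fun N => fst (exp_partial n X N j k)) (fst z) /\
     Un_cv (fun N => snd (exp_partial n X N j k)) (snd z)).
  { intros j k. destruct (lt_dec j n) as [Hj|]; [|exists C0; tauto].
    destruct (lt_dec k n) as [Hk|]; [|exists C0; tauto].
    destruct (Rcomplete.R_complete _ (Hcauchy j k Hj Hk fst (fun _ _ => eq_refl)
                (fun z => ltac:(unfold Cnorm2; nra)))) as [a Ha].
    destruct (Rcomplete.R_complete _ (Hcauchy j k Hj Hk snd (fun _ _ => eq_refl)
                (fun z => ltac:(unfold Cnorm2; nra)))) as [b Hb].
    exists (a, b); auto. }
  exists (fun j k => epsilon (inhabits C0) (fun z => (j < n)%nat -> (k < n)%nat ->
     Un_cv (fun N => fst (exp_partial n X N j k)) (fst z) /\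
     Un_cv (fun N => snd (exp_partial n X N j k)) (snd z))).
  intros j k Hj Hk. exact (epsilon_spec (inhabits C0) _ (Hlim j k) Hj Hk).
Qed.

(** [N] is fixed before [n] and [X]: one degree of truncation serves matrices of all sizes with norm
    at most [L]. The bound is the limit of those between partial sums. *)
Lemma spec_norm_matexp_tail L eps : 0 <= L -> 0 < eps -> exists N, forall n X,
  spec_norm_le n X L -> spec_norm_le n (matsub (matexp n X) (exp_partial n X N)) eps.
Proof.
  intros HL He. destruct (exp_series_tail L eps HL He) as [N HN]. exists N. intros n X HX.
  apply (spec_norm_lim n (fun p => matsub (exp_partial n X (p + N)) (exp_partial n X N))); [lra| |].
  - intros p. rewrite (Nat.add_comm p N).
    eapply spec_norm_weaken; [|apply spec_norm_exp_partial_tail; eauto]. apply HN; lia.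
  - intros j k Hj Hk. destruct (matexp_correct n X L HL HX j k Hj Hk) as [H1 H2].
    apply is_lim_seq_Reals in H1, H2.
    split.
    + apply (is_lim_seq_minus' (fun p => fst (exp_partial n X (p + N) j k)) (fun _ => fst (exp_partial n X N j k)));
        [|apply is_lim_seq_const].
      now apply (is_lim_seq_incr_n (fun p => fst (exp_partial n X p j k)) N).
    + apply (is_lim_seq_minus' (fun p => snd (exp_partial n X (p + N) j k)) (fun _ => snd (exp_partial n X N j k)));
        [|apply is_lim_seq_const].
      now apply (is_lim_seq_incr_n (fun p => snd (exp_partial n X p j k)) N).
Qed.

Lemma ess_small_pow X Y L : 0 <= L ->
  (forall n, (0 < n)%nat -> spec_norm_le n (X n) L) ->
  (forall n, (0 < n)%nat -> spec_norm_le n (Y n) L) ->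
  ess_small (fun n => matsub (X n) (Y n)) ->
  forall m, ess_small (fun n => matsub (matpow n (X n) m) (matpow n (Y n) m)).
Proof.
  intros HL HX HY HXY m. induction m.
  - apply (ess_small_ext (fun _ _ _ => C0)), ess_small_zero.
    intros n j k _ _; simpl; unfold matsub; ring.
  - (* X^(m+1) - Y^(m+1) = X^m (X - Y) + (X^m - Y^m) Y *)
    apply (ess_small_ext (fun n => matadd (matmul n (matpow n (X n) m) (matsub (X n) (Y n)))
             (matmul n (matsub (matpow n (X n) m) (matpow n (Y n) m)) (Y n)))).
    + intros n j k _ _. cbn [matpow]. unfold matsub at 3. unfold matadd, matmul, Csub.
      (* The sign becomes a factor [-1], which [Csum_mul_l] can carry inside the sum. *)
      replace (Copp (Csum n (fun i => Cmul (matpow n (Y n) m j i) (Y n i k))))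
        with (Cmul (Copp C1) (Csum n (fun i => Cmul (matpow n (Y n) m j i) (Y n i k)))) by ring.
      rewrite <- Csum_mul_l, <- !Csum_add. apply Csum_ext; intros. unfold matsub; ring.
    + apply ess_small_add.
      * apply ess_small_mul_l with (L ^ m); auto using pow_le.
        intros; apply spec_norm_pow; auto.
      * now apply ess_small_mul_r with L.
Qed.

(** Truncating at a common degree costs [eps / 2] for each exponential; the difference of the
    truncations is a fixed finite combination of the [X n ^ m - Y n ^ m]. *)
Lemma ess_small_exp X Y L : 0 <= L ->
  (forall n, (0 < n)%nat -> spec_norm_le n (X n) L) ->
  (forall n, (0 < n)%nat -> spec_norm_le n (Y n) L) ->
  ess_small (fun n => matsub (X n) (Y n)) ->
  ess_small (fun n => matsub (matexp n (X n)) (matexp n (Y n))).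
Proof.
  intros HL HX HY HXY. apply ess_small_approx. intros eps He.
  destruct (spec_norm_matexp_tail L (eps / 2) HL) as [N HN]; [lra|].
  exists (fun n => matsub (exp_partial n (X n) N) (exp_partial n (Y n) N)). split.
  - clear HN. induction N.
    + apply (ess_small_ext (fun _ _ _ => C0)), ess_small_zero.
      intros n j k _ _; simpl; unfold matsub; ring.
    + apply (ess_small_ext (fun n => matadd (matsub (exp_partial n (X n) N) (exp_partial n (Y n) N))
         (cmatscal (RtoC (/ INR (fact (S N)))) (matsub (matpow n (X n) (S N)) (matpow n (Y n) (S N)))))).
      * intros n j k _ _. cbn [exp_partial]. unfold matsub, matadd.
        rewrite !matscal_cmatscal. unfold cmatscal; ring.
      * apply ess_small_add; auto.
        apply (ess_small_cmatscal _ (fun n => matsub (matpow n (X n) (S N)) (matpow n (Y n) (S N)))).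
        now apply ess_small_pow with L.
  - intros n Hn.
    apply (spec_norm_ext n (matsub (matsub (matexp n (X n)) (exp_partial n (X n) N))
                                   (matsub (matexp n (Y n)) (exp_partial n (Y n) N)))).
    + intros j k _ _; unfold matsub; ring.
    + replace eps with (eps / 2 + eps / 2) by field. apply spec_norm_sub; auto.
Qed.

(** * Toeplitz matrices and their optimal circulants *)

Definition toep (a : Z -> C) : Mat := fun j k => a (Z.of_nat j - Z.of_nat k)%Z.

(** The formula of [opt_circulant] for an arbitrary coefficient sequence, so that linearity in [a]
    can be exploited. *)
Definition circ (a : Z -> C) (n : nat) : Mat := fun j k =>
  let d := Z.to_nat (Z.modulo (Z.of_nat j - Z.of_nat k) (Z.of_nat n)) in
  Cscal (/ INR n) (Cadd (Cscal (INR n - INR d) (a (Z.of_nat d)))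
                        (Cscal (INR d) (a (Z.of_nat d - Z.of_nat n)%Z))).

(* The optimal circulant is the average of the conjugates of the Toeplitz matrix by the
   cyclic permutations. *)
Lemma circ_average a n j k : (j < n)%nat -> (k < n)%nat ->
  circ a n j k =
  Cscal (/ INR n) (Csum n (fun s => toep a ((j + s) mod n)%nat ((k + s) mod n)%nat)).
Proof.
  intros Hj Hk. unfold circ. set (d := Z.to_nat _). f_equal.
  assert (Hd : (d < n)%nat).
  { unfold d. generalize (Z.mod_pos_bound (Z.of_nat j - Z.of_nat k) (Z.of_nat n)); lia. }
  set (H := fun t => toep a ((d + t) mod n)%nat (t mod n)%nat).
  rewrite (Csum_ext n _ (fun s => H (s + k)%nat)).
  - rewrite (Csum_rot n k H).
    (* For the first [n - d] values of [t] the row index [d + t] stays below [n] and the entry is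
       [a d]; for the last [d] values it wraps around and the entry is [a (d - n)]. These counts are
       the two weights in [circ]. *)
    + replace n with ((n - d) + d)%nat at 3 by lia. rewrite Csum_split.
      rewrite (Csum_ext (n - d) _ (fun _ => a (Z.of_nat d))).
      * rewrite (Csum_ext d _ (fun _ => a (Z.of_nat d - Z.of_nat n)%Z)).
        -- rewrite !Csum_const, minus_INR by lia; reflexivity.
        -- intros i Hi. unfold H, toep. f_equal.
           rewrite (Nat.mod_small (n - d + i)) by lia.
           replace (d + (n - d + i))%nat with (i + 1 * n)%nat by lia.
           rewrite Nat.Div0.mod_add, Nat.mod_small by lia. lia.
      * intros i Hi. unfold H, toep. f_equal. rewrite !Nat.mod_small by lia. lia.
    + intros i. unfold H. f_equal.
      * replace (d + (i + n))%nat with (d + i + 1 * n)%nat by lia. apply Nat.Div0.mod_add.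
      * replace (i + n)%nat with (i + 1 * n)%nat by lia. apply Nat.Div0.mod_add.
  (* The summand depends only on [s + k], because [j] is congruent to [d + k] modulo [n]. *)
  - intros s Hs. unfold H. f_equal; [|f_equal; lia].
    apply Nat2Z.inj. rewrite !Nat2Z.inj_mod, !Nat2Z.inj_add. unfold d.
    rewrite Z2Nat.id by (apply Z.mod_pos_bound; lia).
    rewrite Zplus_mod_idemp_l. f_equal; lia.
Qed.

(** Permuting coordinates preserves [vnorm], so every conjugate in the average of [circ_average]
    obeys the same bound. *)
Lemma spec_norm_circ a n e : (0 < n)%nat ->
  spec_norm_le n (toep a) e -> spec_norm_le n (circ a n) e.
Proof.
  intros Hn HT.
  apply (spec_norm_ext n (matscal (/ INR n)
    (fun j k => Csum n (fun s => toep a ((j + s) mod n)%nat ((k + s) mod n)%nat)))).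
  - intros j k Hj Hk. symmetry. now apply circ_average.
  - assert (HnR : 0 < INR n) by (apply lt_0_INR; lia).
    replace e with (Rabs (/ INR n) * (INR n * e)).
    2:{ rewrite Rabs_right; [field; lra|]. apply Rle_ge, Rlt_le, Rinv_0_lt_compat; auto. }
    apply spec_norm_matscal.
    apply (spec_norm_Csum n n (fun s j k => toep a ((j + s) mod n)%nat ((k + s) mod n)%nat)).
    intros s Hs x.
    (* Shifting by [n - s] is shifting by [-s] modulo [n]; thus [y] at [(i + s) mod n] is [x i]. *)
    set (y := fun i => x ((i + (n - s)) mod n)%nat).
    assert (Hy : vnorm n y = vnorm n x).
    { unfold vnorm; f_equal. apply (Rsum_rot_mod n (n - s) (fun i => Cnorm2 (x i)) Hn). }
    assert (Hmv : vnorm n (matvec n (fun j k => toep a ((j + s) mod n)%nat ((k + s) mod n)%nat) x)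
                  = vnorm n (matvec n (toep a) y)).
    { unfold vnorm; f_equal.
      rewrite <- (Rsum_rot_mod n s (fun i => Cnorm2 (matvec n (toep a) y i)) Hn).
      apply Rsum_ext; intros j Hj. f_equal. unfold matvec.
      rewrite <- (Csum_rot_mod n s (fun i => Cmul (toep a ((j + s) mod n)%nat i) (y i)) Hn).
      apply Csum_ext; intros i Hi. f_equal. unfold y.
      rewrite Nat.Div0.add_mod_idemp_l.
      replace (i + s + (n - s))%nat with (i + 1 * n)%nat by lia.
      now rewrite Nat.Div0.mod_add, Nat.mod_small. }
    rewrite Hmv, <- Hy. apply HT.
Qed.

(** The Fourier coefficients of [exp (i m t)], as [cfourier_cis] shows. *)
Definition Zdelta (m d : Z) : C := if Z.eqb d m then C1 else C0.

(** With [r = |m|], the circulant equals [1 - r / n] times the Toeplitz matrix outside the first [r]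
    rows and columns, where the wrapped diagonals lie. The discrepancy [r / n] tends to zero. *)
Lemma ess_small_circ_delta m L : 0 <= L ->
  (forall n, (0 < n)%nat -> spec_norm_le n (toep (Zdelta m)) L) ->
  ess_small (fun n => matsub (circ (Zdelta m) n) (toep (Zdelta m))).
Proof.
  intros HL HT eps He.
  set (r := Z.to_nat (Z.abs m)).
  (* This makes [r * L / n], the bound on the norm of [E], at most [eps] for [n > N]. *)
  destruct (INR_unbounded (INR r * L / eps)) as [N HN].
  exists (Nat.max N r), (r + r)%nat. intros n Hn.
  assert (HnR : 0 < INR n) by (apply lt_0_INR; lia).
  set (E := matscal (- INR r / INR n) (toep (Zdelta m))).
  exists (matsub (matsub (circ (Zdelta m) n) (toep (Zdelta m))) E), E. repeat split.
  - intros j k _ _; unfold matadd, matsub; ring.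
  - apply rank_le_border. intros j k Hj Hk Hrj Hrk.
    unfold E, matsub, matscal, circ, toep, Zdelta.
    (* [q] tells whether reducing [j - k] modulo [n] wraps around. *)
    assert (Hmod : exists q, (q = 0 \/ q = 1)%Z /\
       ((Z.of_nat j - Z.of_nat k) mod Z.of_nat n = Z.of_nat j - Z.of_nat k + q * Z.of_nat n)%Z /\
       (q = 0 -> Z.of_nat k <= Z.of_nat j)%Z /\ (q = 1 -> Z.of_nat j < Z.of_nat k)%Z).
    { destruct (le_lt_dec k j).
      - exists 0%Z. rewrite Z.mod_small by lia. lia.
      - exists 1%Z. rewrite <- (Z.mod_add _ 1), Z.mod_small by lia. lia. }
    destruct Hmod as (q & Hq & -> & Hq0 & Hq1).
    set (d := Z.to_nat _). assert (Hd : Z.of_nat d = (Z.of_nat j - Z.of_nat k + q * Z.of_nat n)%Z) by lia.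
    rewrite Hd.
    destruct (Z.eqb_spec (Z.of_nat j - Z.of_nat k) m) as [Hm|Hm].
    (* On the diagonal [j - k = m] exactly one coefficient in [circ] survives, with weight
       [1 - r / n]: here [d = r] without wrapping and [d = n - r] with it. *)
    + destruct Hq as [-> | ->].
      * replace (_ =? m)%Z with true by (symmetry; apply Z.eqb_eq; lia).
        replace (_ =? m)%Z with false by (symmetry; apply Z.eqb_neq; lia).
        replace r with d by lia. apply C_eq; simpl; field; lra.
      * replace (_ =? m)%Z with false by (symmetry; apply Z.eqb_neq; lia).
        replace (_ =? m)%Z with true by (symmetry; apply Z.eqb_eq; lia).
        replace (INR r) with (INR n - INR d) by (rewrite <- minus_INR by lia; f_equal; lia).
        apply C_eq; simpl; field; lra.
    (* Off that diagonal both coefficients vanish: the diagonals [m - n] and [m + n] meet the matrix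
       only in the excluded border. *)
    + replace (_ =? m)%Z with false by (symmetry; apply Z.eqb_neq; lia).
      replace (_ =? m)%Z with false by (symmetry; apply Z.eqb_neq; lia).
      apply C_eq; simpl; ring.
  - apply (spec_norm_weaken n _ (Rabs (- INR r / INR n) * L)).
    + assert (HNn : INR N <= INR n) by (apply le_INR; lia).
      unfold Rdiv. rewrite Rabs_mult, Rabs_Ropp, (Rabs_right (INR r)), (Rabs_right (/ INR n)).
      * apply Rmult_le_reg_r with (INR n); auto. field_simplify; [|lra].
        assert (INR r * L / eps < INR n) by lra.
        apply (Rmult_lt_compat_r eps) in H; auto. field_simplify in H; lra.
      * apply Rle_ge, Rlt_le, Rinv_0_lt_compat; auto.
      * apply Rle_ge, pos_INR.
    + apply spec_norm_matscal, HT; lia.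
Qed.

(** * Means over a period *)

Definition cont (h : R -> R) : Prop := forall t, continuous h t.
Definition Ccont (h : R -> C) : Prop := cont (fun t => fst (h t)) /\ cont (fun t => snd (h t)).
Definition mean (h : R -> R) : R := / (2 * PI) * RInt h (- PI) PI.
Definition cmean (h : R -> C) : C := (mean (fun t => fst (h t)), mean (fun t => snd (h t))).

Lemma cont_continuity h : continuity h -> cont h.
Proof. intros H t. apply continuity_pt_filterlim, H. Qed.

Lemma cont_const c : cont (fun _ => c).
Proof. intros t; apply continuous_const. Qed.

Lemma cont_plus f g : cont f -> cont g -> cont (fun t => f t + g t).
Proof. intros Hf Hg t. apply (continuous_plus f g); auto. Qed.

Lemma cont_opp f : cont f -> cont (fun t => - f t).
Proof. intros Hf t. apply (continuous_opp f); auto. Qed.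

Lemma cont_mult f g : cont f -> cont g -> cont (fun t => f t * g t).
Proof. intros Hf Hg t. apply (continuous_mult f g); auto. Qed.

Lemma cont_minus f g : cont f -> cont g -> cont (fun t => f t - g t).
Proof. intros Hf Hg. apply cont_plus; auto using cont_opp. Qed.

Lemma Ccont_const c : Ccont (fun _ => c).
Proof. split; apply cont_const. Qed.

Lemma Ccont_add f g : Ccont f -> Ccont g -> Ccont (fun t => Cadd (f t) (g t)).
Proof. intros [H1 H2] [H3 H4]. split; apply cont_plus; auto. Qed.

Lemma Ccont_mul f g : Ccont f -> Ccont g -> Ccont (fun t => Cmul (f t) (g t)).
Proof.
  intros [H1 H2] [H3 H4]. split; simpl;
    [apply cont_minus|apply cont_plus]; apply cont_mult; auto.
Qed.

Lemma Ccont_sub f g : Ccont f -> Ccont g -> Ccont (fun t => Csub (f t) (g t)).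
Proof. intros [H1 H2] [H3 H4]. split; simpl; apply cont_plus; auto using cont_opp. Qed.

Lemma Ccont_conj f : Ccont f -> Ccont (fun t => Cconj (f t)).
Proof. intros [H1 H2]. split; simpl; auto using cont_opp. Qed.

Lemma Ccont_Csum n (f : nat -> R -> C) :
  (forall i, (i < n)%nat -> Ccont (f i)) -> Ccont (fun t => Csum n (fun i => f i t)).
Proof.
  induction n; intros H; simpl; [apply Ccont_const|].
  apply Ccont_add; [apply IHn; intros|]; apply H; lia.
Qed.

Lemma Ccont_cis f : cont f -> Ccont (fun t => cis (f t)).
Proof.
  intros Hf. split; intros t; simpl.
  - apply (continuous_comp f cos); [apply Hf|]. apply continuity_pt_filterlim, continuity_cos.
  - apply (continuous_comp f sin); [apply Hf|]. apply continuity_pt_filterlim, continuity_sin.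
Qed.

Lemma cont_lin c : cont (fun t => c * t).
Proof. apply cont_mult; [apply cont_const|intros t; apply continuous_id]. Qed.

Lemma cont_Cnorm2 f : Ccont f -> cont (fun t => Cnorm2 (f t)).
Proof. intros [H1 H2]. apply cont_plus; apply cont_mult; auto. Qed.

Lemma cont_ex_RInt h a b : cont h -> ex_RInt h a b.
Proof. intros H. apply (ex_RInt_continuous (V := R_CompleteNormedModule)). intros; apply H. Qed.

Lemma mean_ext f g : (forall t, f t = g t) -> mean f = mean g.
Proof. intros H. unfold mean. f_equal. apply RInt_ext. intros; apply H. Qed.

Lemma mean_plus f g : cont f -> cont g -> mean (fun t => f t + g t) = mean f + mean g.
Proof.
  intros Hf Hg. unfold mean.
  rewrite (RInt_plus (V := R_CompleteNormedModule) f g) by now apply cont_ex_RInt.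
  unfold plus; simpl; ring.
Qed.

Lemma mean_scal c f : cont f -> mean (fun t => c * f t) = c * mean f.
Proof.
  intros Hf. unfold mean.
  rewrite (RInt_scal (V := R_CompleteNormedModule) f) by now apply cont_ex_RInt.
  unfold scal; simpl; unfold mult; simpl; ring.
Qed.

Lemma mean_minus f g : cont f -> cont g -> mean (fun t => f t - g t) = mean f - mean g.
Proof.
  intros Hf Hg.
  rewrite (mean_ext _ (fun t => f t + -1 * g t)) by (intros; ring).
  rewrite mean_plus, mean_scal; auto; [ring|]. apply cont_mult; auto using cont_const.
Qed.

Lemma mean_const c : mean (fun _ => c) = c.
Proof.
  unfold mean. rewrite RInt_const. unfold scal; simpl; unfold mult; simpl.
  field. generalize PI_RGT_0; lra.
Qed.

Lemma mean_le f g : cont f -> cont g ->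
  (forall t, - PI <= t <= PI -> f t <= g t) -> mean f <= mean g.
Proof.
  intros Hf Hg H. assert (Hpi := PI_RGT_0). unfold mean.
  apply Rmult_le_compat_l; [apply Rlt_le, Rinv_0_lt_compat; lra|].
  apply RInt_le; try (now apply cont_ex_RInt); [lra|]. intros; apply H; lra.
Qed.

Lemma cmean_ext f g : (forall t, f t = g t) -> cmean f = cmean g.
Proof. intros H. unfold cmean. f_equal; apply mean_ext; intros; now rewrite H. Qed.

Lemma cmean_add f g : Ccont f -> Ccont g ->
  cmean (fun t => Cadd (f t) (g t)) = Cadd (cmean f) (cmean g).
Proof. intros [H1 H2] [H3 H4]. apply C_eq; simpl; apply mean_plus; auto. Qed.

Lemma cmean_mul_l c f : Ccont f -> cmean (fun t => Cmul c (f t)) = Cmul c (cmean f).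
Proof.
  intros [H1 H2].
  assert (Hs : forall r h, cont h -> cont (fun t => r * h t)).
  { intros; apply cont_mult; auto using cont_const. }
  apply C_eq; simpl; [rewrite mean_minus|rewrite mean_plus]; auto; rewrite !mean_scal; auto.
Qed.

Lemma cmean_Csum n (f : nat -> R -> C) :
  (forall i, (i < n)%nat -> Ccont (f i)) ->
  cmean (fun t => Csum n (fun i => f i t)) = Csum n (fun i => cmean (f i)).
Proof.
  induction n; intros H; simpl.
  - apply C_eq; simpl; apply mean_const.
  - rewrite <- IHn by (intros; apply H; lia).
    apply (cmean_add (fun t => Csum n (fun i => f i t)) (f n)); [|apply H; lia].
    apply Ccont_Csum; intros; apply H; lia.
Qed.

(** Orthogonality of the exponentials: for [d <> 0] the antiderivatives [sin (d t) / d] and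
    [- cos (d t) / d] agree at [- PI] and [PI]. *)
Lemma cmean_cis d : cmean (fun t => cis (IZR d * t)) = Zdelta 0 d.
Proof.
  unfold Zdelta. destruct (Z.eqb_spec d 0) as [->|Hd].
  - rewrite (cmean_ext _ (fun _ => C1)) by (intros; rewrite Rmult_0_l; apply cis_0).
    apply C_eq; simpl; apply mean_const.
  - assert (Hd' : IZR d <> 0) by (intros H; apply Hd; now apply eq_IZR).
    destruct (Ccont_cis (fun t => IZR d * t) (cont_lin _)) as [Hc Hs]. simpl in Hc, Hs.
    apply C_eq; simpl; unfold mean.
    + replace (RInt (fun t => cos (IZR d * t)) (- PI) PI) with 0; [ring|]. symmetry.
      apply (is_RInt_unique (V := R_CompleteNormedModule)).
      replace 0 with (minus (sin (IZR d * PI) / IZR d) (sin (IZR d * - PI) / IZR d)).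
      * apply (is_RInt_derive (V := R_CompleteNormedModule) (fun t => sin (IZR d * t) / IZR d)); [|intros; apply Hc].
        intros t _. auto_derive; [auto|]. field; auto.
      * unfold minus, plus, opp; simpl.
        rewrite (sin_eq_0_1 (IZR d * PI)) by (now exists d).
        rewrite (sin_eq_0_1 (IZR d * - PI)); [field; auto|].
        exists (- d)%Z. rewrite opp_IZR; ring.
    + replace (RInt (fun t => sin (IZR d * t)) (- PI) PI) with 0; [ring|]. symmetry.
      apply (is_RInt_unique (V := R_CompleteNormedModule)).
      replace 0 with (minus (- cos (IZR d * PI) / IZR d) (- cos (IZR d * - PI) / IZR d)).
      * apply (is_RInt_derive (V := R_CompleteNormedModule) (fun t => - cos (IZR d * t) / IZR d)); [|intros; apply Hs].
        intros t _. auto_derive; [auto|]. field; auto.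
      * unfold minus, plus, opp; simpl.
        replace (IZR d * - PI) with (- (IZR d * PI)) by ring. rewrite cos_neg. field; auto.
Qed.

(** * Fourier coefficients and the norm of Toeplitz matrices *)

Definition cfourier (F : R -> C) (k : Z) : C :=
  cmean (fun t => Cmul (F t) (cis (- (IZR k * t)))).

Lemma Ccont_cis_lin c : Ccont (fun t => cis (c * t)).
Proof. apply Ccont_cis, cont_lin. Qed.

Lemma Ccont_cfourier F (k : Z) : Ccont F -> Ccont (fun t => Cmul (F t) (cis (- (IZR k * t)))).
Proof. intros HF. apply Ccont_mul; auto. apply Ccont_cis, cont_opp, cont_lin. Qed.

(** Continuity provides a Riemann integral, so the value chosen by [Rint] is the total integral
    [RInt]. *)
Lemma fourier_cfourier u v k : continuity u -> continuity v ->
  fourier u v k = cfourier (fun t => (u t, v t)) k.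
Proof.
  intros Hu Hv. apply cont_continuity in Hu, Hv.
  assert (HRint : forall g, cont g -> Rint g (- PI) PI = RInt g (- PI) PI).
  { intros g Hg. unfold Rint.
    destruct (epsilon_spec (inhabits 0)
      (fun I => exists pr : Riemann_integrable g (- PI) PI, RiemannInt pr = I)) as [pr Hpr].
    - assert (pr : Riemann_integrable g (- PI) PI) by (apply ex_RInt_Reals_0, cont_ex_RInt; auto).
      now exists (RiemannInt pr), pr.
    - rewrite <- Hpr. symmetry. apply RInt_Reals. }
  destruct (Ccont_cis_lin (IZR k)) as [Hc Hs]. simpl in Hc, Hs.
  unfold fourier. rewrite !HRint.
  - apply C_eq; simpl; apply mean_ext; intros t; rewrite cos_neg, sin_neg; ring.
  - apply cont_minus; apply cont_mult; auto.
  - apply cont_plus; apply cont_mult; auto.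
Qed.

Lemma cfourier_cis m k : cfourier (fun t => cis (IZR m * t)) k = Zdelta m k.
Proof.
  unfold cfourier. rewrite (cmean_ext _ (fun t => cis (IZR (m - k) * t))).
  - rewrite cmean_cis. unfold Zdelta.
    destruct (Z.eqb_spec (m - k) 0), (Z.eqb_spec k m); auto; lia.
  - intros t. rewrite <- cis_add, minus_IZR. f_equal; ring.
Qed.

Lemma cfourier_sub F G k : Ccont F -> Ccont G ->
  cfourier (fun t => Csub (F t) (G t)) k = Csub (cfourier F k) (cfourier G k).
Proof.
  intros HF HG. unfold cfourier.
  rewrite (cmean_ext _ (fun t => Cadd (Cmul (F t) (cis (- (IZR k * t))))
                          (Cmul (Copp C1) (Cmul (G t) (cis (- (IZR k * t))))))) by (intros; ring).
  rewrite cmean_add, cmean_mul_l; auto using Ccont_cfourier; [ring|].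
  apply Ccont_mul; auto using Ccont_const, Ccont_cfourier.
Qed.

Definition trigpoly (n : nat) (x : Vec) (t : R) : C :=
  Csum n (fun k => Cmul (x k) (cis (INR k * t))).

Lemma Ccont_trigpoly n x : Ccont (trigpoly n x).
Proof.
  apply (Ccont_Csum n (fun k t => Cmul (x k) (cis (INR k * t)))). intros.
  apply Ccont_mul; auto using Ccont_const, Ccont_cis_lin.
Qed.

(** The mean of [F X conj(Y)] is [y* A x], where [A] is the Toeplitz matrix of [F]: integrating [F]
    against [exp (i (k - j) t)] gives the entry [(j, k)]. Parseval, the norm bound and the Fejér
    mean all come from this identity. *)
Lemma cmean_sesquilinear F n x y : Ccont F ->
  cmean (fun t => Cmul (F t) (Cmul (trigpoly n x t) (Cconj (trigpoly n y t))))
  = Csum n (fun j => Cmul (Cconj (y j)) (matvec n (toep (cfourier F)) x j)).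
Proof.
  intros HF.
  rewrite (cmean_ext _ (fun t => Csum n (fun j => Csum n (fun k =>
     Cmul (Cmul (Cconj (y j)) (x k))
       (Cmul (F t) (cis (- (IZR (Z.of_nat j - Z.of_nat k) * t)))))))).
  - assert (Hc : forall j k, Ccont (fun t => Cmul (Cmul (Cconj (y j)) (x k))
       (Cmul (F t) (cis (- (IZR (Z.of_nat j - Z.of_nat k) * t)))))).
    { intros; apply Ccont_mul; auto using Ccont_const, Ccont_cfourier. }
    rewrite (cmean_Csum n (fun j t => Csum n (fun k =>
     Cmul (Cmul (Cconj (y j)) (x k))
       (Cmul (F t) (cis (- (IZR (Z.of_nat j - Z.of_nat k) * t))))))).
    + apply Csum_ext; intros j Hj. rewrite (cmean_Csum n (fun k t =>
        Cmul (Cmul (Cconj (y j)) (x k))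
          (Cmul (F t) (cis (- (IZR (Z.of_nat j - Z.of_nat k) * t)))))) by auto.
      unfold matvec. rewrite <- Csum_mul_l. apply Csum_ext; intros k Hk.
      rewrite cmean_mul_l by auto using Ccont_cfourier. unfold toep, cfourier; ring.
    + intros j _. apply (Ccont_Csum n (fun k t => Cmul (Cmul (Cconj (y j)) (x k))
          (Cmul (F t) (cis (- (IZR (Z.of_nat j - Z.of_nat k) * t)))))); auto.
  - intros t. unfold trigpoly. rewrite Cconj_Csum, <- Csum_mul_l, <- Csum_mul_l.
    apply Csum_ext; intros j Hj. rewrite <- Csum_mul_r, <- Csum_mul_l.
    apply Csum_ext; intros k Hk. rewrite Cconj_mul, Cconj_cis.
    replace (- (IZR (Z.of_nat j - Z.of_nat k) * t)) with (INR k * t + - (INR j * t)).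
    + rewrite cis_add; ring.
    + rewrite minus_IZR, <- !INR_IZR_INZ; ring.
Qed.

(** Parseval: the symbol [1] has the identity as its Toeplitz matrix. *)
Lemma mean_Cnorm2_trigpoly n x :
  mean (fun t => Cnorm2 (trigpoly n x t)) = Rsum n (fun i => Cnorm2 (x i)).
Proof.
  transitivity (fst (cmean (fun t => Cmul ((fun _ => C1) t)
                  (Cmul (trigpoly n x t) (Cconj (trigpoly n x t)))))).
  - apply mean_ext; intros t; simpl. unfold Cnorm2; ring.
  - rewrite cmean_sesquilinear by apply Ccont_const. rewrite fst_Csum.
    apply Rsum_ext; intros j Hj.
    replace (matvec n (toep (cfourier (fun _ => C1))) x j) with (x j); [now rewrite Cmul_conj|].
    assert (H1 : forall d, cfourier (fun _ => C1) d = Zdelta 0 d).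
    { intros d. rewrite <- cfourier_cis. apply cmean_ext; intros t.
      now rewrite Rmult_0_l, cis_0. }
    unfold matvec, toep. rewrite (Csum_single n _ j); auto.
    + rewrite H1, Z.sub_diag. unfold Zdelta; simpl; ring.
    + intros i _ Hi. rewrite H1. unfold Zdelta.
      destruct (Z.eqb_spec (Z.of_nat j - Z.of_nat i) 0); [lia|ring].
Qed.

(* With [y := A x], integrate [0 <= |F X - Y|^2] over a period. *)
Lemma spec_norm_toep F e n : Ccont F -> 0 <= e ->
  (forall t, - PI <= t <= PI -> Cnorm2 (F t) <= e * e) ->
  spec_norm_le n (toep (cfourier F)) e.
Proof.
  intros HF He Hb x. set (y := matvec n (toep (cfourier F)) x).
  set (W := fun t => Cmul (F t) (Cmul (trigpoly n x t) (Cconj (trigpoly n y t)))).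
  assert (HW : Ccont W).
  { repeat apply Ccont_mul; auto using Ccont_conj, Ccont_trigpoly. }
  assert (HX := cont_Cnorm2 _ (Ccont_trigpoly n x)).
  assert (HY := cont_Cnorm2 _ (Ccont_trigpoly n y)).
  assert (Hsc : forall r h, cont h -> cont (fun t => r * h t)).
  { intros; apply cont_mult; auto using cont_const. }
  assert (Hmean : mean (fun t => 2 * fst (W t)) <=
     mean (fun t => e * e * Cnorm2 (trigpoly n x t) + Cnorm2 (trigpoly n y t))).
  { apply mean_le; [apply Hsc, HW|apply cont_plus; auto|].
    intros t Ht. assert (H1 := Hb t Ht). assert (H2 := Cnorm2_ge0 (trigpoly n x t)).
    assert (H3 := Cnorm2_ge0 (Csub (Cmul (F t) (trigpoly n x t)) (trigpoly n y t))).
    replace (Cnorm2 (Csub _ _)) with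
      (Cnorm2 (F t) * Cnorm2 (trigpoly n x t) - 2 * fst (W t) + Cnorm2 (trigpoly n y t)) in H3.
    - nra.
    - unfold W, Cnorm2, Csub, Cadd, Copp, Cmul, Cconj; simpl; ring. }
  rewrite mean_plus, !mean_scal, !mean_Cnorm2_trigpoly in Hmean; auto; [|apply HW].
  replace (mean (fun t => fst (W t))) with (fst (cmean W)) in Hmean by reflexivity.
  unfold W in Hmean. rewrite cmean_sesquilinear in Hmean by auto. fold y in Hmean.
  rewrite fst_Csum, (Rsum_ext n _ (fun i => Cnorm2 (y i))) in Hmean
    by (intros; now rewrite Cmul_conj).
  rewrite <- !vnorm_sqr in Hmean.
  (* As [y = A x], [Hmean] now reads [2 |y|^2 <= e^2 |x|^2 + |y|^2], which gives [|y| <= e |x|]. *)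
  assert (H1 := vnorm_ge0 n x). assert (H2 := vnorm_ge0 n y).
  apply Rsqr_incr_0_var; [|nra]. unfold Rsqr. nra.
Qed.

Lemma spec_norm_toep_Zdelta m n : spec_norm_le n (toep (Zdelta m)) 1.
Proof.
  apply (spec_norm_ext n (toep (cfourier (fun t => cis (IZR m * t))))).
  - intros j k _ _. apply cfourier_cis.
  - apply spec_norm_toep; [apply Ccont_cis_lin|lra|]. intros; rewrite Cnorm2_cis; lra.
Qed.

(** * Fejér approximation *)

(** The Fejér kernel as a squared modulus, which makes it visibly nonnegative. *)
Definition fejer (K : nat) (t : R) : R :=
  / INR K * Cnorm2 (Csum K (fun k => cis (INR k * t))).

(** The Cesàro mean of the Fourier series: the frequency [m] occurs for [K - |m|] pairs when
    [|m| < K]. The double sum matches [cmean_sesquilinear]. *)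
Definition fejer_poly (K : nat) (F : R -> C) (x : R) : C :=
  Csum K (fun j => Csum K (fun k =>
    Cmul (Cscal (/ INR K) (cfourier F (Z.of_nat j - Z.of_nat k)))
         (cis (IZR (Z.of_nat j - Z.of_nat k) * x)))).

Lemma fejer_trigpoly K x s :
  fejer K (s - x) = / INR K * Cnorm2 (trigpoly K (fun k => cis (- (INR k * x))) s).
Proof.
  unfold fejer, trigpoly. do 2 f_equal. apply Csum_ext; intros. rewrite <- cis_add. f_equal; ring.
Qed.

Lemma cont_fejer K x : cont (fun s => fejer K (s - x)).
Proof.
  assert (H : cont (fun s => / INR K * Cnorm2 (trigpoly K (fun k => cis (- (INR k * x))) s))).
  { apply cont_mult; [apply cont_const|]. apply cont_Cnorm2, Ccont_trigpoly. }
  intros t. eapply continuous_ext; [|apply H]. intros s; symmetry; apply fejer_trigpoly.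
Qed.

Lemma mean_fejer K x : (0 < K)%nat -> mean (fun s => fejer K (s - x)) = 1.
Proof.
  intros HK. rewrite (mean_ext _ _ (fejer_trigpoly K x)).
  rewrite mean_scal by apply cont_Cnorm2, Ccont_trigpoly. rewrite mean_Cnorm2_trigpoly.
  rewrite (Rsum_ext K _ (fun _ => 1)) by (intros; apply Cnorm2_cis).
  rewrite Rsum_const. field. apply not_0_INR; lia.
Qed.

Lemma fejer_ge0 K t : (0 < K)%nat -> 0 <= fejer K t.
Proof.
  intros HK. apply Rmult_le_pos; [|apply Cnorm2_ge0].
  apply Rlt_le, Rinv_0_lt_compat, lt_0_INR; lia.
Qed.

(** The geometric sum telescopes to [(1 - exp (i t)) S = 1 - exp (i K t)], and
    [|1 - exp (i r)|^2 = 2 - 2 cos r <= 4]. The product form avoids dividing by zero when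
    [cos t = 1]. *)
Lemma fejer_bound K t : (0 < K)%nat -> fejer K t * (2 - 2 * cos t) <= 4 / INR K.
Proof.
  intros HK. assert (HKR : 0 < INR K) by (apply lt_0_INR; lia).
  assert (Htel : Cmul (Csub C1 (cis t)) (Csum K (fun k => cis (INR k * t))) = Csub C1 (cis (INR K * t))).
  { clear. induction K.
    - simpl. rewrite Rmult_0_l, cis_0; ring.
    - cbn [Csum]. replace (INR (S K) * t) with (t + INR K * t) by (rewrite S_INR; ring).
      rewrite cis_add.
      replace (Cmul _ _) with (Cadd (Cmul (Csub C1 (cis t)) (Csum K (fun k => cis (INR k * t))))
                   (Cmul (Csub C1 (cis t)) (cis (INR K * t)))) by ring.
      rewrite IHK; ring. }
  apply (f_equal Cnorm2) in Htel. rewrite Cnorm2_mul in Htel.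
  assert (Hn : forall r, Cnorm2 (Csub C1 (cis r)) = 2 - 2 * cos r).
  { intros r. generalize (Cnorm2_cis r). unfold Cnorm2, Csub, Cadd, Copp, cis; simpl. nra. }
  rewrite !Hn in Htel. unfold fejer.
  replace (/ INR K * _ * _) with ((2 - 2 * cos (INR K * t)) / INR K) by (rewrite <- Htel; field; lra).
  apply Rmult_le_compat_r; [apply Rlt_le, Rinv_0_lt_compat; lra|].
  generalize (COS_bound (INR K * t)); lra.
Qed.

(** This is [cmean_sesquilinear] with both vectors equal to [w], whose trigonometric polynomial has
    squared modulus [K] times the kernel centred at [x]. *)
Lemma fejer_poly_mean K F x : Ccont F ->
  fejer_poly K F x = (mean (fun s => fst (F s) * fejer K (s - x)),
                      mean (fun s => snd (F s) * fejer K (s - x))).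
Proof.
  intros HF. set (w := fun k => cis (- (INR k * x))).
  assert (HW : Ccont (fun s => Cmul (F s) (Cmul (trigpoly K w s) (Cconj (trigpoly K w s))))).
  { apply Ccont_mul; auto. apply Ccont_mul; auto using Ccont_conj, Ccont_trigpoly. }
  transitivity (Cmul (RtoC (/ INR K))
    (cmean (fun s => Cmul (F s) (Cmul (trigpoly K w s) (Cconj (trigpoly K w s)))))).
  - rewrite cmean_sesquilinear by auto. unfold fejer_poly. rewrite <- Csum_mul_l.
    apply Csum_ext; intros j _. unfold matvec. rewrite <- !Csum_mul_l.
    apply Csum_ext; intros k _. rewrite Cscal_RtoC. unfold w, toep.
    replace (IZR (Z.of_nat j - Z.of_nat k) * x) with (INR j * x + - (INR k * x)).
    + rewrite Cconj_cis, Ropp_involutive, cis_add; ring.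
    + rewrite minus_IZR, <- !INR_IZR_INZ; ring.
  - rewrite <- cmean_mul_l by auto.
    apply C_eq; simpl; apply mean_ext; intros s; rewrite fejer_trigpoly; fold w;
      unfold Cnorm2; ring.
Qed.

Lemma cos_gap a t : 0 < a -> a <= PI -> a <= t <= 2 * PI - a -> cos t <= cos a.
Proof.
  intros Ha HaP Ht. destruct (Rle_dec t PI).
  - apply cos_decr_1; lra.
  - replace (cos t) with (cos (2 * PI - t)).
    + apply cos_decr_1; lra.
    + rewrite <- (cos_neg t), <- (cos_period (- t) 1). f_equal; simpl; ring.
Qed.

(** The penalty [2 - 2 * cos (s - x)] is the factor that [fejer_bound] controls. It vanishes at
    [s - x = 0] and at a full period; near these uniform continuity suffices, and elsewhere the
    penalty absorbs the oscillation of [u]. *)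
Lemma periodic_modulus u eps : continuity u -> (forall t, u (t + 2 * PI) = u t) -> 0 < eps ->
  exists B, 0 <= B /\ forall x s, - PI <= x <= PI -> - PI <= s <= PI ->
    Rabs (u s - u x) <= eps + B * (2 - 2 * cos (s - x)).
Proof.
  intros Hu Hper He. assert (Hpi := PI_RGT_0).
  destruct (continuity_ab_maj u (- PI) PI) as (a & Ha & _); [lra|intros; apply Hu|].
  destruct (continuity_ab_min u (- PI) PI) as (b & Hb & _); [lra|intros; apply Hu|].
  (* The interval is long enough to contain [x + 2 * PI]. *)
  destruct (Heine u (fun t => - PI <= t <= 3 * PI) (compact_P3 _ _) (fun t _ => Hu t) (mkposreal eps He))
    as [[d Hd] Hunif]. simpl in Hunif.
  set (d' := Rmin d PI).
  assert (Hd' : 0 < d' /\ d' <= d /\ d' <= PI).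
  { unfold d', Rmin; destruct (Rle_dec d PI); lra. }
  assert (Hcos : cos d' < 1) by (rewrite <- cos_0; apply cos_decreasing_1; lra).
  assert (Hab : 0 <= u a - u b) by (generalize (Ha 0) (Hb 0); lra).
  (* [B] makes the smallest penalty at distance [d'] from the period points equal to the full
     oscillation. *)
  set (B := (u a - u b) / (2 - 2 * cos d')).
  assert (HB : B * (2 - 2 * cos d') = u a - u b) by (unfold B; field; lra).
  assert (HB0 : 0 <= B) by nra.
  exists B. split; auto.
  assert (Hmain : forall x s, - PI <= x <= PI -> - PI <= s <= PI -> x <= s ->
    Rabs (u s - u x) <= eps + B * (2 - 2 * cos (s - x))).
  { intros x s Hx Hs Hxs. assert (Hc := COS_bound (s - x)).
    assert (0 <= B * (2 - 2 * cos (s - x))) by (apply Rmult_le_pos; lra).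
    destruct (Rlt_dec (s - x) d').
    - assert (Rabs (u s - u x) < eps) by (apply Hunif; try (apply Rabs_def1); lra). lra.
    (* When [s] and [x] are near opposite ends, [x] is moved by one period to come close to [s]. *)
    - destruct (Rlt_dec (2 * PI - d') (s - x)).
      + rewrite <- (Hper x).
        assert (Rabs (u s - u (x + 2 * PI)) < eps) by (apply Hunif; try (apply Rabs_def1); lra). lra.
      + assert (cos (s - x) <= cos d') by (apply cos_gap; lra).
        assert (Rabs (u s - u x) <= u a - u b).
        { generalize (Ha s Hs) (Ha x Hx) (Hb s Hs) (Hb x Hx); intros.
          apply Rabs_le; lra. }
        nra. }
  intros x s Hx Hs. destruct (Rle_dec x s); [auto|].
  rewrite Rabs_minus_sym. replace (s - x) with (- (x - s)) by ring. rewrite cos_neg.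
  apply Hmain; auto; lra.
Qed.

(** The kernel has mean one, so the error is a mean of [u s - u x] against it. [periodic_modulus]
    and [fejer_bound] bound the integrand by a function of mean [eps / 2 + eps / 2]. *)
Lemma fejer_approx_real u eps : continuity u -> (forall t, u (t + 2 * PI) = u t) -> 0 < eps ->
  exists N, forall K, (N < K)%nat -> forall x, - PI <= x <= PI ->
    Rabs (u x - mean (fun s => u s * fejer K (s - x))) <= eps.
Proof.
  intros Hu Hper He.
  destruct (periodic_modulus u (eps / 2) Hu Hper) as (B & HB & Hmod); [lra|].
  (* Exactly what [B * (4 / K) <= eps / 2] requires. *)
  destruct (INR_unbounded (8 * B / eps)) as [N HN].
  exists N. intros K HK x Hx.
  assert (HK0 : (0 < K)%nat) by lia.
  assert (HKR : 0 < INR K) by (apply lt_0_INR; lia).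
  assert (HB' : B * (4 / INR K) <= eps / 2).
  { assert (INR N <= INR K) by (apply le_INR; lia).
    assert (8 * B / eps < INR K) by lra.
    apply (Rmult_lt_compat_r eps) in H0; auto. field_simplify in H0; [|lra].
    apply Rmult_le_reg_r with (INR K); auto. field_simplify; lra. }
  apply cont_continuity in Hu. assert (Hf := cont_fejer K x).
  assert (Huf : cont (fun s => u s * fejer K (s - x))) by now apply cont_mult.
  assert (Hsc : forall r, cont (fun s => r * fejer K (s - x))).
  { intros; apply cont_mult; auto using cont_const. }
  assert (Hpt : forall s, - PI <= s <= PI ->
     Rabs (u s - u x) * fejer K (s - x) <= eps / 2 * fejer K (s - x) + eps / 2).
  { intros s Hs. generalize (Hmod x s Hx Hs) (fejer_ge0 K (s - x) HK0) (fejer_bound K (s - x) HK0).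
    intros H1 H2 H3.
    apply Rle_trans with ((eps / 2 + B * (2 - 2 * cos (s - x))) * fejer K (s - x)).
    - now apply Rmult_le_compat_r.
    - assert (B * (fejer K (s - x) * (2 - 2 * cos (s - x))) <= B * (4 / INR K))
        by now apply Rmult_le_compat_l.
      lra. }
  assert (H1 : mean (fun s => u s * fejer K (s - x) - u x * fejer K (s - x))
     <= mean (fun s => eps / 2 * fejer K (s - x) + eps / 2)).
  { apply mean_le; [apply cont_minus; auto|apply cont_plus; auto using cont_const|].
    intros s Hs. assert (H2 := Hpt s Hs). assert (H3 := Rle_abs (u s - u x)).
    assert (H4 := fejer_ge0 K (s - x) HK0). nra. }
  assert (H2 : mean (fun s => u x * fejer K (s - x) - u s * fejer K (s - x))
     <= mean (fun s => eps / 2 * fejer K (s - x) + eps / 2)).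
  { apply mean_le; [apply cont_minus; auto|apply cont_plus; auto using cont_const|].
    intros s Hs. assert (H2 := Hpt s Hs). assert (H3 := Rle_abs (- (u s - u x))).
    rewrite Rabs_Ropp in H3.
    assert (H4 := fejer_ge0 K (s - x) HK0). nra. }
  rewrite mean_minus, mean_plus, !mean_scal, mean_const, mean_fejer in H1, H2;
    auto using cont_const.
  apply Rabs_le; lra.
Qed.

Lemma fejer_approx u v eps : continuity u -> continuity v ->
  (forall t, u (t + 2 * PI) = u t) -> (forall t, v (t + 2 * PI) = v t) -> 0 < eps ->
  exists K, forall x, - PI <= x <= PI ->
    Cnorm2 (Csub (u x, v x) (fejer_poly K (fun t => (u t, v t)) x)) <= eps * eps.
Proof.
  intros Hu Hv Hup Hvp He.
  destruct (fejer_approx_real u (eps / 2) Hu Hup) as [N1 H1]; [lra|].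
  destruct (fejer_approx_real v (eps / 2) Hv Hvp) as [N2 H2]; [lra|].
  exists (S (Nat.max N1 N2)). intros x Hx.
  assert (H3 := H1 (S (Nat.max N1 N2)) ltac:(lia) x Hx).
  assert (H4 := H2 (S (Nat.max N1 N2)) ltac:(lia) x Hx).
  rewrite fejer_poly_mean by (split; now apply cont_continuity).
  unfold Cnorm2, Csub, Cadd, Copp. cbn [fst snd].
  set (p := mean _) in *. set (q := mean _) in *.
  (* Each part is at most [eps / 2], and [2 * (eps / 2)^2 <= eps^2]. *)
  apply Rabs_le_between in H3, H4. nra.
Qed.

Lemma cfourier_fejer_poly K F m : cfourier (fejer_poly K F) m =
  Csum K (fun j => Csum K (fun k =>
    Cmul (Cscal (/ INR K) (cfourier F (Z.of_nat j - Z.of_nat k)))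
         (Zdelta (Z.of_nat j - Z.of_nat k) m))).
Proof.
  set (c := fun j k => Cscal (/ INR K) (cfourier F (Z.of_nat j - Z.of_nat k))).
  set (g := fun (j k : nat) t => Cmul (c j k)
              (Cmul (cis (IZR (Z.of_nat j - Z.of_nat k) * t)) (cis (- (IZR m * t))))).
  assert (Hg : forall j k, Ccont (g j k)).
  { intros; apply Ccont_mul; [apply Ccont_const|]. apply (Ccont_cfourier (fun t => cis _)).
    apply Ccont_cis_lin. }
  unfold cfourier at 1.
  rewrite (cmean_ext _ (fun t => Csum K (fun j => Csum K (fun k => g j k t)))).
  - rewrite (cmean_Csum K (fun j t => Csum K (fun k => g j k t))).
    + apply Csum_ext; intros j _. rewrite (cmean_Csum K (g j)) by auto.
      apply Csum_ext; intros k _. unfold g. rewrite cmean_mul_l.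
      * rewrite <- cfourier_cis. reflexivity.
      * apply (Ccont_cfourier (fun t => cis _)). apply Ccont_cis_lin.
    + intros; apply (Ccont_Csum K (g i)); auto.
  - intros t. unfold fejer_poly. rewrite <- Csum_mul_r. apply Csum_ext; intros j _.
    rewrite <- Csum_mul_r. apply Csum_ext; intros k _. unfold g, c; ring.
Qed.

Lemma Ccont_fejer_poly K F : Ccont (fejer_poly K F).
Proof.
  apply (Ccont_Csum K (fun j x => Csum K (fun k =>
    Cmul (Cscal (/ INR K) (cfourier F (Z.of_nat j - Z.of_nat k)))
         (cis (IZR (Z.of_nat j - Z.of_nat k) * x))))). intros j _.
  apply (Ccont_Csum K (fun k x =>
    Cmul (Cscal (/ INR K) (cfourier F (Z.of_nat j - Z.of_nat k)))
         (cis (IZR (Z.of_nat j - Z.of_nat k) * x)))). intros k _.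
  apply Ccont_mul; auto using Ccont_const, Ccont_cis_lin.
Qed.

(** * The error of the optimal circulant *)

Lemma circ_ext a b n : (forall d, a d = b d) -> forall j k, circ a n j k = circ b n j k.
Proof. intros H j k. unfold circ. now rewrite !H. Qed.

Definition circ_error (a : Z -> C) (n : nat) : Mat := matsub (circ a n) (toep a).

Lemma circ_error_ext a b n : (forall d, a d = b d) -> meq n (circ_error a n) (circ_error b n).
Proof. intros H j k _ _. unfold circ_error, matsub, toep. now rewrite (circ_ext a b), H. Qed.

(** Both constructions are linear in the coefficient sequence; this reduces a trigonometric
    polynomial to single frequencies. *)
Lemma circ_error_Csum K (c : nat -> C) (a : nat -> Z -> C) n j k :
  circ_error (fun d => Csum K (fun i => Cmul (c i) (a i d))) n j k =
  Csum K (fun i => Cmul (c i) (circ_error (a i) n j k)).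
Proof.
  induction K; simpl.
  - unfold circ_error, circ, matsub, toep. rewrite !Cscal_RtoC; ring.
  - rewrite <- IHK. unfold circ_error, circ, matsub, toep. rewrite !Cscal_RtoC; ring.
Qed.

Lemma ess_small_circ_error_fejer_poly K F :
  ess_small (circ_error (cfourier (fejer_poly K F))).
Proof.
  set (c := fun j k => Cscal (/ INR K) (cfourier F (Z.of_nat j - Z.of_nat k))).
  apply (ess_small_ext (fun n p q => Csum K (fun j => Csum K (fun k =>
           Cmul (c j k) (circ_error (Zdelta (Z.of_nat j - Z.of_nat k)) n p q))))).
  - intros n p q Hp Hq.
    rewrite (circ_error_ext _ _ n (cfourier_fejer_poly K F) p q Hp Hq).
    (* The dummy factor [C1] gives the outer sum the shape required by [circ_error_Csum]. *)
    rewrite (circ_error_ext _ (fun d => Csum K (fun j => Cmul C1 (Csum K (fun k =>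
               Cmul (c j k) (Zdelta (Z.of_nat j - Z.of_nat k) d)))))); auto.
    + rewrite (circ_error_Csum K (fun _ => C1)). apply Csum_ext; intros j _.
      rewrite (circ_error_Csum K (c j) (fun k => Zdelta (Z.of_nat j - Z.of_nat k))).
      symmetry; apply (Rmul_1_l C_ring).
    + intros d. apply Csum_ext; intros i _. symmetry; apply (Rmul_1_l C_ring).
  - apply (ess_small_Csum K (fun j n p q => Csum K (fun k =>
           Cmul (c j k) (circ_error (Zdelta (Z.of_nat j - Z.of_nat k)) n p q)))). intros j _.
    apply (ess_small_Csum K (fun k n p q =>
           Cmul (c j k) (circ_error (Zdelta (Z.of_nat j - Z.of_nat k)) n p q))). intros k _.
    apply (ess_small_cmatscal (c j k) (circ_error (Zdelta (Z.of_nat j - Z.of_nat k)))).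
    apply (ess_small_circ_delta _ 1); [lra|]. intros; apply spec_norm_toep_Zdelta.
Qed.

(** The remainder [F - P] has modulus at most [eps / 2] on a period, hence so do the norms of its
    Toeplitz matrix and of its circulant; their difference costs [eps]. *)
Lemma ess_small_circ_error u v : continuity u -> continuity v ->
  (forall t, u (t + 2 * PI) = u t) -> (forall t, v (t + 2 * PI) = v t) ->
  ess_small (circ_error (cfourier (fun t => (u t, v t)))).
Proof.
  intros Hu Hv Hup Hvp. apply ess_small_approx. intros eps He.
  destruct (fejer_approx u v (eps / 2) Hu Hv Hup Hvp) as [K HK]; [lra|].
  set (F := fun t => (u t, v t)). set (P := fejer_poly K F).
  assert (HF : Ccont F) by (split; now apply cont_continuity).
  assert (HP : Ccont P) by apply Ccont_fejer_poly.
  exists (circ_error (cfourier P)). split; [apply ess_small_circ_error_fejer_poly|].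
  intros n Hn. set (a := cfourier (fun t => Csub (F t) (P t))).
  assert (Ha : spec_norm_le n (toep a) (eps / 2)).
  { apply spec_norm_toep; [apply Ccont_sub; auto|lra|exact HK]. }
  apply (spec_norm_ext n (matsub (circ a n) (toep a))).
  - intros j k _ _. unfold circ_error, matsub, circ, toep.
    unfold a. rewrite !cfourier_sub by auto. rewrite !Cscal_RtoC; ring.
  - replace eps with (eps / 2 + eps / 2) by field.
    apply spec_norm_sub; auto. now apply spec_norm_circ.
Qed.

Lemma Cnorm2_bounded u v : continuity u -> continuity v ->
  exists L, 0 <= L /\ forall t, - PI <= t <= PI -> Cnorm2 (u t, v t) <= L * L.
Proof.
  intros Hu Hv. assert (Hpi := PI_RGT_0).
  destruct (continuity_ab_maj (fun t => u t * u t + v t * v t) (- PI) PI) as (a & Ha & _); [lra| |].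
  - intros c _. apply (continuity_plus (fun t => u t * u t) (fun t => v t * v t));
      apply continuity_mult; auto.
  - exists (sqrt (u a * u a + v a * v a)). split; [apply sqrt_pos|].
    intros t Ht. rewrite sqrt_sqrt by nra. now apply Ha.
Qed.

Theorem mainTheorem2 (u v : R -> R)
  (hu : continuity u) (hv : continuity v)
  (hup : forall t, u (t + 2 * PI) = u t) (hvp : forall t, v (t + 2 * PI) = v t) :
  forall eps : R, 0 < eps ->
  exists N M : nat, (0 < N)%nat /\ (0 < M)%nat /\
    forall n : nat, (N < n)%nat ->
      exists Rn En : Mat,
        (forall j k, (j < n)%nat -> (k < n)%nat ->
           matsub (matexp n (opt_circulant u v n)) (matexp n (toeplitz u v)) j k
           = matadd Rn En j k) /\
        rank_le n Rn (2 * M) /\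
        spec_norm_le n En eps.
Proof.
  destruct (Cnorm2_bounded u v hu hv) as (L & HL & Hb).
  set (F := fun t => (u t, v t)).
  assert (HF : forall d, cfourier F d = fourier u v d).
  { intros; symmetry; now apply fourier_cfourier. }
  assert (HT : forall n, (0 < n)%nat -> spec_norm_le n (toeplitz u v) L).
  { intros n _. apply (spec_norm_ext n (toep (cfourier F))).
    - intros j k _ _. apply HF.
    - apply spec_norm_toep; auto. split; now apply cont_continuity. }
  assert (HC : forall n, (0 < n)%nat -> spec_norm_le n (opt_circulant u v n) L).
  (* [opt_circulant u v n] is [circ (fourier u v) n] by unfolding. *)
  { intros n Hn. apply (spec_norm_circ (fourier u v) n L Hn), HT, Hn. }
  assert (HS : ess_small (fun n => matsub (opt_circulant u v n) (toeplitz u v))).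
  { apply (ess_small_ext (circ_error (cfourier F))).
    - intros n. exact (circ_error_ext _ _ n HF).
    - now apply ess_small_circ_error. }
  intros eps He.
  destruct (ess_small_exp _ _ L HL HC HT HS eps He) as (N & r & HN).
  (* Successors ensure positivity, and [r <= 2 * S r] leaves room for the rank. *)
  exists (S N), (S r). repeat split; try lia. intros n Hn.
  destruct (HN n) as (Rn & En & H1 & H2 & H3); [lia|].
  exists Rn, En. repeat split; auto. apply rank_le_weaken with r; auto; lia.
Qed.
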